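(* For every language $L\subseteq\Sigma^*$ recognized by a 2D1CA, there exists a simple 2R1CA $M'$ which recognizes $L$ with no error: every $x\in L$ is accepted by $M'$ with probability $1$ and every $x\in\Sigma^*\setminus L$ is rejected by $M'$ with probability $1$.
   Context: Let $\Sigma$ be a finite alphabet, $\Gamma=\Sigma\cup\{\cent,\$\}$ with end-markers $\cent,\$\notin\Sigma$, $S=\{0,1\}$, $\mathrm{sign}(k)=0$ if $k=0$ and $1$ otherwise, and $\mu(\leftarrow)=-1,\mu(\downarrow)=0,\mu(\rightarrow)=+1$. 2D1CA: $M=(Q,\Sigma,\delta,q_0,Q_{\rm acc},Q_{\rm rej})$ with finite $Q$, initial state $q_0$, disjoint $Q_{\rm acc},Q_{\rm rej}\subset Q$, and $\delta:Q\times\Gamma\times S\to Q\times\{-1,0,+1\}\times\{\leftarrow,\downarrow,\rightarrow\}$. On input $x$ of length $n$ the circular tape holds $w_x=\cent x\$$ at positions $0,\dots,n+1$ (modulo $n+2$); start in $q_0$, counter $0$, head at $0$; from (state $q$, counter $a$, head $b$), if $\delta(q,w_x(b),\mathrm{sign}(a))=(q',c,d)$ go to $(q',a+c,b+\mu(d))$; halt upon entering $Q_{\rm acc}$ (accept) or $Q_{\rm rej}$ (reject). $M$ recognizes $L$ if on every input it halts, accepting iff $x\in L$. 2Q1CA: $M=(Q,\Sigma,\delta,q_0,Q_{\rm acc},Q_{\rm rej})$ with finite $Q$, $q_0\in Q$, disjoint $Q_{\rm acc},Q_{\rm rej}\subset Q$, and $\delta:Q\times\Gamma\times S\times Q\times\{-1,0,+1\}\times\{\leftarrow,\downarrow,\rightarrow\}\to\mathbb{C}$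 satisfying the well-formedness conditions below. For $\alpha,\beta\in\{-2,\dots,2\}$ let $W_{\alpha,\beta}(q_1,\sigma_1,s_1;q_2,\sigma_2,s_2)=\sum_{q'\in Q}\sum\overline{\delta(q_1,\sigma_1,s_1,q',c_1,d_1)}\,\delta(q_2,\sigma_2,s_2,q',c_2,d_2)$, inner sum over $(c_1,d_1),(c_2,d_2)$ with $c_2-c_1=\alpha$, $\mu(d_2)-\mu(d_1)=\beta$. Well-formedness: for all $q_1,q_2\in Q$, $\sigma,\sigma_1,\sigma_2\in\Gamma$, $s,s_1,s_2\in S$: (i) $W_{0,0}(q_1,\sigma,s;q_2,\sigma,s)=[q_1=q_2]$; (ii) $W_{0,\beta}(q_1,\sigma_1,s;q_2,\sigma_2,s)=0$ for $\beta\in\{1,2\}$; (iii) $W_{\alpha,0}(q_1,\sigma,s_1;q_2,\sigma,s_2)=0$ for $\alpha\in\{1,2\}$; (iv) $W_{\alpha,\beta}(q_1,\sigma_1,s_1;q_2,\sigma_2,s_2)=0$ for $\alpha\in\{1,2\}$, $\beta\in\{-2,-1,1,2\}$. On input $x$ of length $n$, configurations are $(q,a,b)\in Q\times\mathbb{Z}\times\{0,\dots,n+1\}$ and $U_x|q,a,b\rangle=\sum_{q',c,d}\delta(q,w_x(b),\mathrm{sign}(a),q',c,d)|q',a+c,b+\mu(d)\rangle$. Computation starts in $|q_0,0,0\rangle$; at each step $U_x$ is applied and then the state is measured w.r.t. the orthogonal decomposition into the spans of configurations whose state lies in $Q_{\rm acc}$, in $Q_{\rm rej}$, and in neither; outcomes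 ''accept''/''reject'' halt, otherwise the computation continues from the collapsed (renormalized) state. Acceptance (rejection) probability is the total probability of ever obtaining the outcome ''accept'' (''reject''). A 2R1CA is a 2Q1CA all of whose transition amplitudes $\delta(\cdot)$ lie in $\{0,1\}$. A 2Q1CA (or 2R1CA) is simple if there are linear operators $V_{\sigma,s}$ on $\ell_2(Q)$, a counter function $C:Q\times\Gamma\to\{-1,0,+1\}$ and a head function $D:Q\to\{\leftarrow,\downarrow,\rightarrow\}$ with $\delta(q,\sigma,s,q',c,d)=\langle q'|V_{\sigma,s}|q\rangle$ if $C(q',\sigma)=c$ and $D(q')=d$, and $0$ otherwise. *)

(* Defs.v *)
From HB Require Import structures.
From mathcomp Require Import all_boot all_order all_algebra.
From mathcomp Require Import all_classical all_reals all_analysis.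
From mathcomp Require Import complex Rstruct Rstruct_topology.
Set Implicit Arguments. Unset Strict Implicit. Unset Printing Implicit Defensive.
Import Order.TTheory GRing.Theory Num.Theory.
Local Open Scope ring_scope.

Definition Rl : realType := Rdefinitions.R.
Definition Cx := (Rl)[i].

Definition cconj (z : Cx) : Cx := Complex (complex.Re z) (- complex.Im z).
Definition sqmod (z : Cx) : Rl := complex.Re z ^+ 2 + complex.Im z ^+ 2.

(* Moves: {-1,0,+1} for the counter and {<-, down, ->} for the head,   *)
(* both encoded by 'I_3 with value i - 1 (so mu(<-)=-1, mu(down)=0,    *)
(* mu(->)=+1).                                                          *)
Definition tri := 'I_3.
Definition tval (t : tri) : int := (nat_of_ord t)%:Z - 1.

Definition Gamma (Sigma : finType) := (Sigma + bool)%type.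
Definition cent {Sigma : finType} : Gamma Sigma := inr false.
Definition dollar {Sigma : finType} : Gamma Sigma := inr true.

Definition sgn (a : int) : bool := a != 0.

Definition pos (Sigma : finType) (x : seq Sigma) := 'I_(size x).+2.

Definition tape (Sigma : finType) (x : seq Sigma) (b : nat) : Gamma Sigma :=
  if b == 0%N then cent
  else match onth x b.-1 with Some a => inl a | None => dollar end.

Definition hshift (Sigma : finType) (x : seq Sigma) (b : pos x) (d : int) : pos x :=
  inord (absz (((nat_of_ord b)%:Z + d) %% ((size x).+2)%:Z)%Z).

Record D1CA (Sigma Q : finType) := {
  d_q0 : Q;
  d_acc : {set Q};
  d_rej : {set Q};
  d_disj : [disjoint d_acc & d_rej];
  d_delta : Q -> Gamma Sigma -> bool -> Q * tri * tri
}.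

Definition dconfig (Sigma : finType) (Q : finType) (x : seq Sigma) :=
  (Q * int * pos x)%type.

Definition dstep (Sigma Q : finType) (M : D1CA Sigma Q) (x : seq Sigma)
  (cf : dconfig Q x) : dconfig Q x :=
  let: (q, a, b) := cf in
  let: (q', c, d) := d_delta M q (tape x b) (sgn a) in
  (q', a + tval c, hshift b (tval d)).

Arguments dstep {Sigma Q} M {x} cf.

Definition drun (Sigma Q : finType) (M : D1CA Sigma Q) (x : seq Sigma) (k : nat) :
  dconfig Q x := iter k (@dstep Sigma Q M x) (d_q0 M, 0, ord0).

Definition dstate (Sigma Q : finType) (M : D1CA Sigma Q) x k : Q := (drun M x k).1.1.

Arguments drun {Sigma Q} M x k.

(* halting upon ENTERING a halting state (steps k >= 1) *)
Definition daccepts (Sigma Q : finType) (M : D1CA Sigma Q) (x : seq Sigma) : Prop :=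
  exists k, (0 < k)%N /\ dstate M x k \in d_acc M /\
    forall j, (0 < j < k)%N -> dstate M x j \notin (d_acc M :|: d_rej M).

Definition drejects (Sigma Q : finType) (M : D1CA Sigma Q) (x : seq Sigma) : Prop :=
  exists k, (0 < k)%N /\ dstate M x k \in d_rej M /\
    forall j, (0 < j < k)%N -> dstate M x j \notin (d_acc M :|: d_rej M).

Definition d_recognizes (Sigma Q : finType) (M : D1CA Sigma Q)
  (L : seq Sigma -> Prop) : Prop :=
  forall x, (L x -> daccepts M x) /\ (~ L x -> drejects M x).

Definition qtrans (Sigma Q : finType) :=
  Q -> Gamma Sigma -> bool -> Q -> tri -> tri -> Cx.

Definition Wf (Sigma Q : finType) (delta : qtrans Sigma Q) (al be : int)
  (q1 : Q) (g1 : Gamma Sigma) (s1 : bool) (q2 : Q) (g2 : Gamma Sigma) (s2 : bool) : Cx :=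
  \sum_(q' : Q) \sum_(c1 : tri) \sum_(d1 : tri) \sum_(c2 : tri) \sum_(d2 : tri
       | (tval c2 - tval c1 == al) && (tval d2 - tval d1 == be))
     cconj (delta q1 g1 s1 q' c1 d1) * delta q2 g2 s2 q' c2 d2.

Definition well_formed (Sigma Q : finType) (delta : qtrans Sigma Q) : Prop :=
  (forall q1 q2 g s,
      Wf delta 0 0 q1 g s q2 g s = (if q1 == q2 then 1 else 0)) /\
  (forall q1 q2 g1 g2 s (be : int), (be == 1) || (be == 2) ->
      Wf delta 0 be q1 g1 s q2 g2 s = 0) /\
  (forall q1 q2 g s1 s2 (al : int), (al == 1) || (al == 2) ->
      Wf delta al 0 q1 g s1 q2 g s2 = 0) /\
  (forall q1 q2 g1 g2 s1 s2 (al be : int), (al == 1) || (al == 2) ->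
      (be == -2) || (be == -1) || (be == 1) || (be == 2) ->
      Wf delta al be q1 g1 s1 q2 g2 s2 = 0).

Record Q1CA (Sigma Q : finType) := {
  q_q0 : Q;
  q_acc : {set Q};
  q_rej : {set Q};
  q_disj : [disjoint q_acc & q_rej];
  q_delta : qtrans Sigma Q;
  q_wf : well_formed q_delta
}.

(* (unnormalised) vectors in l2 of configurations (q, a, b) *)
Definition qstate (Sigma Q : finType) (x : seq Sigma) := Q -> int -> pos x -> Cx.

(* U_x psi, written coordinatewise:
   U_x |q,a,b> = sum delta(q, w_x(b), sign a, q', c, d) |q', a + c, b + mu(d)> *)
Definition Ux (Sigma Q : finType) (M : Q1CA Sigma Q) (x : seq Sigma)
  (psi : qstate Q x) : qstate Q x :=
  fun q' a' b' =>
    \sum_(q : Q) \sum_(c : tri) \sum_(d : tri) \sum_(b : pos x | hshift b (tval d) == b')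
      q_delta M q (tape x b) (sgn (a' - tval c)) q' c d * psi q (a' - tval c) b.

Arguments Ux {Sigma Q} M {x} psi _ _ _.

Definition proj_non (Sigma Q : finType) (M : Q1CA Sigma Q) (x : seq Sigma)
  (psi : qstate Q x) : qstate Q x :=
  fun q a b => if (q \in q_acc M) || (q \in q_rej M) then 0 else psi q a b.

Arguments proj_non {Sigma Q} M {x} psi _ _ _.

Definition qinit (Sigma Q : finType) (M : Q1CA Sigma Q) (x : seq Sigma) : qstate Q x :=
  fun q a b => if (q == q_q0 M) && (a == 0) && (nat_of_ord b == 0%N) then 1 else 0.

Arguments qinit {Sigma Q} M x _ _ _.

(* unnormalised non-halting part of the state after k steps
   (the computation having continued at each of the k measurements) *)
Fixpoint qrun (Sigma Q : finType) (M : Q1CA Sigma Q) (x : seq Sigma) (k : nat) :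
  qstate Q x :=
  if k is k'.+1 then proj_non M (Ux M (@qrun Sigma Q M x k')) else qinit M x.

Arguments qrun {Sigma Q} M x k.

Definition zsum (K : nat) (f : int -> Rl) : Rl :=
  \sum_(i < (K.*2).+1) f ((nat_of_ord i)%:Z - K%:Z).

(* probability of the outcome in H at the (k+1)-st measurement.
   qrun M x k is supported on counter values in [-k,k], so U_x (qrun M x k)
   is supported on [-(k+1), k+1]: the window sum is the full l2 sum. *)
Definition pstep (Sigma Q : finType) (M : Q1CA Sigma Q) (x : seq Sigma)
  (H : {set Q}) (k : nat) : Rl :=
  \sum_(q in H) zsum k.+1 (fun a => \sum_(b : pos x) sqmod (Ux M (qrun M x k) q a b)).

Local Open Scope classical_set_scope.
Definition acc_prob_is (Sigma Q : finType) (M : Q1CA Sigma Q) (x : seq Sigma) (p : Rl) :=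
  (fun N => \sum_(k < N) pstep M x (q_acc M) k) @ \oo --> p.

Definition rej_prob_is (Sigma Q : finType) (M : Q1CA Sigma Q) (x : seq Sigma) (p : Rl) :=
  (fun N => \sum_(k < N) pstep M x (q_rej M) k) @ \oo --> p.

Definition is_R1CA (Sigma Q : finType) (M : Q1CA Sigma Q) : Prop :=
  forall q g s q' c d, q_delta M q g s q' c d = 0 \/ q_delta M q g s q' c d = 1.

(* simple: delta(q,g,s,q',c,d) = <q'|V_{g,s}|q> if C(q',g)=c and D(q')=d, else 0;
   the operator V_{g,s} on l2(Q) is given by its matrix entries V g s q' q = <q'|V|q>. *)
Definition is_simple (Sigma Q : finType) (M : Q1CA Sigma Q) : Prop :=
  exists (V : Gamma Sigma -> bool -> Q -> Q -> Cx) (Cf : Q -> Gamma Sigma -> tri)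
         (D : Q -> tri),
    forall q g s q' c d,
      q_delta M q g s q' c d =
        (if (Cf q' g == c) && (D q' == d) then V g s q' q else 0).

(* Main.v *)
(* A simple reversible automaton is one in which each letter and sign permute the states
   while head and counter moves are determined by the state being entered.  The given
   automaton is first put on a linear tape (which is scanned back whenever the circular
   head would cross the junction) and then made reversible.

   A deterministic machine can be replaced by the Euler tour of the tree of its ancestor
   configurations: a step is preceded by the exploration of the other predecessors.  The
   tour is local and injective, and it reaches the halting configuration as soon as the
   set of ancestors of every configuration is finite.  That holds if the nonzero graph,
   i.e. the transition graph on pairs (state, cell) for a nonzero counter, is acyclic:
   then every ancestor chain meets counter zero regularly.

   A cycle of the nonzero graph, however, may be followed arbitrarily often while the
   counter returns to zero.  Each cycle gets one cut vertex, and a run reaching a cut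
   vertex for the second time since the counter was zero is moved one round ahead: the
   uncut ancestors of the current configuration are explored, again by an Euler tour,
   until one is met that has just left zero.  It exists because the counter must drift
   towards zero along the cycle (otherwise M would not halt), so that the path by which
   the first visit was reached from zero, shifted by the drift of a round, starts beyond
   zero.  The new machine has an acyclic nonzero graph.

   Whether a vertex is cut depends on the return behaviour of M on the cells to its left,
   which is the label of a deterministic finite automaton reading the tape.  A reversible
   machine can carry such labels: if each letter acts on labels by a permutation or a
   constant, a label is recovered when the head retreats by walking back to the last
   constant letter; the general case follows by induction on the number of labels. *)
Require Import Defs.
From HB Require Import structures.
From mathcomp Require Import all_boot all_order all_algebra.
From mathcomp Require Import all_classical all_reals all_analysis.
From mathcomp Require Import complex Rstruct Rstruct_topology.
From mathcomp Require Import zify.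
Set Implicit Arguments. Unset Strict Implicit. Unset Printing Implicit Defensive.
Import Order.TTheory GRing.Theory Num.Theory.
Local Open Scope ring_scope.

(** * Partial machines with moves determined by the target state *)

Local Notation mu := Defs.tval.

Definition tri0 : tri := @Ordinal 3 1 isT.
Definition triL : tri := @Ordinal 3 0 isT.
Definition triR : tri := @Ordinal 3 2 isT.
Definition tneg (t : tri) : tri := rev_ord t.

Lemma mu_tri0 : mu tri0 = 0. Proof. by []. Qed.
Lemma mu_triL : mu triL = -1. Proof. by []. Qed.
Lemma mu_triR : mu triR = 1. Proof. by []. Qed.
Lemma mu_tneg t : mu (tneg t) = - mu t.
Proof. by rewrite /Defs.tval /tneg /=; have := ltn_ord t; lia. Qed.
Lemma mu_bound t : -1 <= mu t <= 1.
Proof. by rewrite /Defs.tval; have := ltn_ord t; lia. Qed.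

Section PartialIteration.
Context {T : Type} (f : T -> option T).

Fixpoint piter (n : nat) (x : T) : option T :=
  if n is n'.+1 then obind (piter n') (f x) else Some x.

Definition reach (x y : T) : Prop := exists n, piter n x = Some y.

Lemma piterD m n x : piter (m + n) x = obind (piter n) (piter m x).
Proof. by elim: m x => //= m IH x; case: (f x) => //= y; rewrite IH. Qed.

Lemma piterSr n x : piter n.+1 x = obind f (piter n x).
Proof.
rewrite -addn1 piterD; case: (piter n x) => //= y.
by case: (f y).
Qed.

Lemma piter_prefix m n x y : (m <= n)%N -> piter n x = Some y ->
  exists2 z, piter m x = Some z & piter (n - m) z = Some y.
Proof.
move=> le_mn; rewrite -{1}(subnKC le_mn) piterD.
by case: (piter m x) => //= z Hz; exists z.
Qed.

Lemma reach_refl x : reach x x. Proof. by exists 0%N. Qed.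

Lemma reach_trans y x z : reach x y -> reach y z -> reach x z.
Proof. by move=> [m Hm] [n Hn]; exists (m + n)%N; rewrite piterD Hm. Qed.

Lemma reach_step x y : f x = Some y -> reach x y.
Proof. by move=> e; exists 1%N; rewrite /= e. Qed.

Lemma reach_next y x z : f x = Some y -> reach y z -> reach x z.
Proof. by move=> /reach_step; exact: reach_trans. Qed.

Lemma reach_last x z : reach x z -> x = z \/ exists2 y, reach x y & f y = Some z.
Proof.
move=> [[|n]]; first by case; left.
by rewrite piterSr; case e: (piter n x) => [y|//] /= fy; right; exists y => //; exists n.
Qed.

Lemma piter_stop_uniq m n x y z : f y = None -> f z = None ->
  piter m x = Some y -> piter n x = Some z -> m = n /\ y = z.
Proof.
move=> fy fz.
elim: m n x => [|m IH] [|n] x /=.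
- by move=> [->] [->].
- by move=> [->]; rewrite fy.
- by move=> + [xz]; rewrite xz fz.
- by case: (f x) => //= t H1 H2; have [-> ->] := IH _ _ H1 H2.
Qed.

Definition recurrent (x : T) : Prop := exists n, piter n.+1 x = Some x.

Lemma recurrentP x : recurrent x <-> exists2 y, f x = Some y & reach y x.
Proof.
split=> [[n] /=|[y fx [n yx]]]; last by exists n; rewrite /= fx.
by case: (f x) => //= y h; exists y => //; exists n.
Qed.

Lemma recurrent_reach x y : recurrent x -> reach x y -> recurrent y.
Proof.
move=> + [n]; elim: n x => [|n IH] x rx /=; first by case=> <-.
case fx: (f x) => [z|//] /= zy; apply: IH zy.
have [y' fx' [k zx]] := (recurrentP x).1 rx.
move: fx'; rewrite fx => -[e]; rewrite -e in zx.
by exists k; rewrite piterSr zx /= fx.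
Qed.

End PartialIteration.

Lemma eq_reach T (f g : T -> option T) x y : f =1 g -> reach f x y -> reach g x y.
Proof. by move=> /funext ->. Qed.

Lemma pigeonhole (T : finType) (f : nat -> T) n : (#|T| <= n)%N ->
  exists i j, (i < j <= n)%N /\ f i = f j.
Proof.
move=> le; have /injectivePn [i [j ij fij]] : ~~ injectiveb (fun i : 'I_n.+1 => f i).
  apply/injectiveP => /leq_card; rewrite card_ord => lt.
  by have := leq_trans lt le; rewrite ltnn.
have := ltn_ord i; have := ltn_ord j; rewrite !ltnS => lj li.
have := ij; rewrite -val_eqE neq_ltn => /orP[] lt; [exists i, j|exists j, i];
  by rewrite lt.
Qed.

(* Head and counter moves are determined by the state being entered.  A step leaving
   the cells [0 .. m] is undefined, and halting states have no successor. *)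
Record machine (A : Type) := Machine {
  mst : finType;
  mdelta : A -> bool -> mst -> option mst;
  mctr : mst -> tri;
  mmov : mst -> tri;
  mini : mst;
  macc : pred mst;
  mrej : pred mst;
  mini_live : ~~ (macc mini || mrej mini);
  macc_rej : forall q, ~~ (macc q && mrej q);
  mhalt : forall a s q, macc q || mrej q -> mdelta a s q = None }.

Definition place := (int * int)%type.

Definition sigd (p : place) : bool := p.1 != 0.

Definition inrange (m : nat) (b : int) : bool := (0 <= b <= m%:Z).

Section Machine.
Context {A : Type} (M : machine A).
Implicit Types (q : mst M) (p : place).

Definition shift q p : place := (p.1 + mu (mctr q), p.2 + mu (mmov q)).
Definition unshift q p : place := (p.1 - mu (mctr q), p.2 - mu (mmov q)).

Lemma shiftK q : cancel (shift q) (unshift q).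
Proof. by case=> a b; rewrite /unshift /shift /=; congr (_, _); lia. Qed.
Lemma unshiftK q : cancel (unshift q) (shift q).
Proof. by case=> a b; rewrite /unshift /shift /=; congr (_, _); lia. Qed.

Definition step (y : int -> A) (m : nat) (c : mst M * place) : option (mst M * place) :=
  if mdelta (y c.2.2) (sigd c.2) c.1 is Some q then
    let p := shift q c.2 in if inrange m p.2 then Some (q, p) else None
  else None.

Definition minit : mst M * place := (mini M, (0, 0)).

(** Moves depend on the entered state alone, so a configuration determines the place it was entered
    from, hence the letter and the sign read there. Local injectivity therefore makes the whole step
    injective. *)
Definition reversible : Prop := forall a s q1 q2 (q' : mst M),
  mdelta a s q1 = Some q' -> mdelta a s q2 = Some q' -> q1 = q2.

End Machine.
Arguments step {A} M y m c.
Arguments minit {A} M.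
Arguments reversible {A} M.

Section Runs.
Context {A : Type} (M : machine A) (y : int -> A) (m : nat).
Implicit Types c : mst M * place.

Lemma step_inrange c c' : step M y m c = Some c' -> inrange m c'.2.2.
Proof. by rewrite /step; case: mdelta => // q; case: ifP => // r [<-]. Qed.

Lemma piter_inrange n c c' : piter (step M y m) n c = Some c' ->
  inrange m c.2.2 -> inrange m c'.2.2.
Proof.
elim: n c => [|n IH] c /=; first by case=> ->.
by case e: (step M y m c) => [d|//] /= /IH H _; apply/H/(step_inrange e).
Qed.

Lemma reach_inrange c c' : reach (step M y m) c c' -> inrange m c.2.2 -> inrange m c'.2.2.
Proof. by case=> n /piter_inrange. Qed.

Lemma init_inrange : inrange m (minit M).2.2.
Proof. by rewrite /inrange /=; lia. Qed.

Lemma reach_move a b st st' a' b' d :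
  mdelta (y b) (a != 0) st = Some st' ->
  a' = a + mu (mctr st') -> b' = b + mu (mmov st') -> inrange m b' ->
  reach (step M y m) (st', (a', b')) d -> reach (step M y m) (st, (a, b)) d.
Proof.
by move=> e -> -> r; apply: reach_next; rewrite /step /= /sigd /= e r.
Qed.

Lemma step_ctr c c' : step M y m c = Some c' -> c.2.1 - 1 <= c'.2.1 <= c.2.1 + 1.
Proof.
rewrite /step; case: mdelta => // q; case: ifP => // r [<-] /=.
by have := mu_bound (mctr q); lia.
Qed.

Lemma piter_ctr n c c' : piter (step M y m) n c = Some c' ->
  c.2.1 - n%:Z <= c'.2.1 <= c.2.1 + n%:Z.
Proof.
elim: n c => [|n IH] c /=; first by case=> ->; lia.
by case e: (step M y m c) => [d|//] /= /IH; have := step_ctr e; lia.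
Qed.

Lemma step_halt c : macc c.1 || mrej c.1 -> step M y m c = None.
Proof. by rewrite /step => h; rewrite mhalt. Qed.

End Runs.

(** * Solving a language on a family of tapes *)

Section Solving.
Context {X : Type} (m : X -> nat).

Definition solves {A : Type} (M : machine A) (T : X -> int -> A) (L : X -> Prop) : Prop :=
  forall x,
    (L x -> exists2 c, reach (step M (T x) (m x)) (minit M) c & macc c.1) /\
    (~ L x -> exists2 c, reach (step M (T x) (m x)) (minit M) c & mrej c.1).

Definition solvable {A : Type} (T : X -> int -> A) (L : X -> Prop) : Prop :=
  exists M : machine A, reversible M /\ solves M T L.

(** The machine for the finer tape reads each letter through [h]. Agreement on the cells in range
    suffices, because a run never leaves them. *)
Lemma solvable_relabel A B (h : A -> B) (T : X -> int -> A) (T' : X -> int -> B) L :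
  (forall x b, inrange (m x) b -> T' x b = h (T x b)) ->
  solvable T' L -> solvable T L.
Proof.
move=> hT [M [rM sM]].
pose M' := @Machine A (mst M) (fun a => mdelta (h a)) (@mctr _ M) (@mmov _ M) (mini M)
  (@macc _ M) (@mrej _ M) (mini_live M) (@macc_rej _ M) (fun a => @mhalt _ M (h a)).
have E x c d : inrange (m x) c.2.2 -> reach (step M (T' x) (m x)) c d ->
    reach (step M' (T x) (m x)) c d.
  move=> + [n]; elim: n c => [|n IH] c rc /=; first by case=> ->; exact: reach_refl.
  case e: (step _ _ _ c) => [c'|//] /= /IH H.
  have e' : step M' (T x) (m x) c = Some c' by move: e; rewrite /step /= -hT.
  exact: reach_next e' (H (step_inrange e)).
exists M'; split=> [a s q1 q2 q'|x]; first exact: rM.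
by split=> [/(sM x).1|/(sM x).2] [c rc ac]; exists c => //; apply: E => //; apply: init_inrange.
Qed.

End Solving.

Lemma triP (t : tri) : [\/ t = triL, t = tri0 | t = triR].
Proof.
by case: t => [[|[|[|//]]] i]; [constructor 1|constructor 2|constructor 3]; apply: val_inj.
Qed.

Lemma tri_eqE : ((triL == tri0) = false) * ((triL == triR) = false) *
  ((tri0 == triL) = false) * ((tri0 == triR) = false) *
  ((triR == triL) = false) * ((triR == tri0) = false).
Proof. by []. Qed.

(** * Reversible machines as quantum automata *)

(** Domain and image of a partial injection have the same size, hence so have their complements,
    which are paired off by rank. *)
Lemma partial_inj_extend (T : finType) (p : T -> option T) :
  (forall q1 q2 q', p q1 = Some q' -> p q2 = Some q' -> q1 = q2) ->
  exists2 f : T -> T, injective f & forall q q', p q = Some q' -> f q = q'.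
Proof.
move=> pinj; pose D : {set T} := finset (fun q => isSome (p q)); pose f q := odflt q (p q).
have fD q : q \in D -> p q = Some (f q) by rewrite inE /f; case: (p q).
have finj : {in D &, injective f}.
  by move=> q1 q2 /fD e1 /fD e2 e; apply: pinj e1 _; rewrite e2 e.
have cE : #|~: D| = #|~: (f @: D)|.
  by rewrite [LHS]cardsCs [RHS]cardsCs !finset.setCK card_in_imset.
pose g q := nth q (enum (~: (f @: D))) (index q (enum (~: D))).
have gI q : q \notin D -> g q \in ~: (f @: D).
  move=> qD; rewrite -mem_enum mem_nth // -cardE -cE cardE index_mem mem_enum.
  by rewrite inE.
exists (fun q => if q \in D then f q else g q); last first.
  by move=> q q' e; have -> : q \in D by [rewrite inE e]; rewrite /f e.
move=> q1 q2; case: ifPn => q1D; case: ifPn => q2D; first exact: finj.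
- by move=> e; have := gI _ q2D; rewrite -e inE imset_f.
- by move=> e; have := gI _ q1D; rewrite e inE imset_f.
have lt q : q \notin D -> (index q (enum (~: D)) < size (enum (~: (f @: D))))%N.
  by move=> qD; rewrite -cardE -cE cardE index_mem mem_enum inE.
move=> /eqP; rewrite /g (set_nth_default q1 q2) ?lt // nth_uniq ?lt ?enum_uniq //.
have mD q : q \notin D -> q \in enum (~: D) by rewrite mem_enum finset.in_setC.
by move=> /eqP /(index_inj q1); apply; apply: mD.
Qed.

Section Quantum.
Variables (Sigma : finType) (M : machine (Gamma Sigma)).
Variable pi : Gamma Sigma -> bool -> mst M -> mst M.
Hypothesis pi_inj : forall g s, injective (pi g s).

Definition perm_delta : qtrans Sigma (mst M) := fun q g s q' c d =>
  if (mctr q' == c) && (mmov q' == d) then (if pi g s q == q' then 1 else 0) else 0.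

(** In a nonzero term both transitions enter the same [q'], which fixes both counter moves and both
    head moves. Only zero differences survive, and the sum is a Kronecker symbol of the two
    targets. *)
Lemma Wf_perm_delta (al be : int) q1 g1 s1 q2 g2 s2 :
  Wf perm_delta al be q1 g1 s1 q2 g2 s2 =
  if [&& al == 0, be == 0 & pi g1 s1 q1 == pi g2 s2 q2] then 1 else 0.
Proof.
rewrite /Wf (bigD1 (pi g1 s1 q1)) //= [X in _ + X]big1 ?addr0 => [|q' nq'].
  set q' := pi g1 s1 q1.
  rewrite (bigD1 (mctr q')) //= [X in _ + X]big1 ?addr0 => [|c1 nc1]; last first.
    rewrite big1 // => d1 _; rewrite big1 // => c2 _; rewrite big1 // => d2 _.
    by rewrite /perm_delta eq_sym (negbTE nc1) /= /cconj /= oppr0 mul0r.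
  rewrite (bigD1 (mmov q')) //= [X in _ + X]big1 ?addr0 => [|d1 nd1]; last first.
    rewrite big1 // => c2 _; rewrite big1 // => d2 _.
    by rewrite /perm_delta [_ == d1]eq_sym (negbTE nd1) andbF /cconj /= oppr0 mul0r.
  rewrite (bigD1 (mctr q')) //= [X in _ + X]big1 ?addr0 => [|c2 nc2]; last first.
    rewrite big1 // => d2 _.
    by rewrite /perm_delta [_ == c2]eq_sym (negbTE nc2) /= mulr0.
  rewrite big_mkcond (bigD1 (mmov q')) //= [X in _ + X]big1 ?addr0 => [|d2 nd2]; last first.
    case: ifP => // _.
    by rewrite /perm_delta [_ == d2]eq_sym (negbTE nd2) andbF mulr0.
  rewrite /perm_delta !eqxx /= !subrr ![0 == _]eq_sym [q' == _]eq_sym.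
  have -> : cconj 1 = 1 by rewrite /cconj /= oppr0.
  by case: (al == 0); case: (be == 0); rewrite //= mul1r.
rewrite big1 // => c1 _; rewrite big1 // => d1 _; rewrite big1 // => c2 _.
rewrite big1 // => d2 _.
by rewrite /perm_delta [_ == q']eq_sym (negbTE nq') if_same /cconj /= oppr0 mul0r.
Qed.

Lemma perm_delta_wf : well_formed perm_delta.
Proof.
split=> [q1 q2 g s|]; first by rewrite Wf_perm_delta !eqxx /= (inj_eq (@pi_inj g s)).
split=> [q1 q2 g1 g2 s be /orP[]/eqP -> |]; [by rewrite Wf_perm_delta..|].
split=> [q1 q2 g1 s1 s2 be /orP[]/eqP -> |]; [by rewrite Wf_perm_delta..|].
by move=> q1 q2 g1 g2 s1 s2 al be /orP[]/eqP -> _; rewrite Wf_perm_delta.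
Qed.

Lemma acc_rej_disjoint : [disjoint finset (@macc _ M) & finset (@mrej _ M)].
Proof.
rewrite finset.disjoints_subset; apply/fintype.subsetP => q; rewrite !inE => aq.
by have := macc_rej q; rewrite aq.
Qed.

Definition perm_Q1CA : Q1CA Sigma (mst M) := Build_Q1CA (mini M) acc_rej_disjoint perm_delta_wf.

Lemma perm_Q1CA_R1CA : is_R1CA perm_Q1CA.
Proof.
by move=> q g s q' c d /=; rewrite /perm_delta; do 2?[case: ifP => _]; [right|left|left].
Qed.

Lemma perm_Q1CA_simple : is_simple perm_Q1CA.
Proof.
by exists (fun g s q' q => if pi g s q == q' then 1 else 0), (fun q' _ => mctr q'),
  (fun q' => mmov q').
Qed.

Section Run.
Variable x : seq Sigma.
Hypothesis piE : forall g s q q', mdelta g s q = Some q' -> pi g s q = q'.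

Let y (b : int) : Gamma Sigma := tape x `|b|%N.

Definition ket (c : mst M * place) : qstate (mst M) x :=
  fun q a b => if [&& q == c.1, a == c.2.1 & (nat_of_ord b)%:Z == c.2.2] then 1 else 0.

Lemma hshift_inrange (b : pos x) (d : int) (b' : pos x) :
  inrange (size x).+1 ((nat_of_ord b)%:Z + d) ->
  (hshift b d == b') = ((nat_of_ord b)%:Z + d == (nat_of_ord b')%:Z).
Proof.
rewrite /inrange /hshift => r.
rewrite modz_small; last by lia.
rewrite -val_eqE /= inordK; last by lia.
by have := ltn_ord b'; lia.
Qed.

(** The permutation [pi] extends the partial step, and a step in range does not cross the junction
    of the circular tape, so a basis vector is sent to a basis vector. *)
Lemma Ux_ket c c' : step M y (size x).+1 c = Some c' -> inrange (size x).+1 c.2.2 ->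
  Ux perm_Q1CA (ket c) = ket c'.
Proof.
case: c => q0 [a0 b0] /=; rewrite /step /=; case eq1: (mdelta _ _ _) => [q1|//] /=.
case: ifP => //= r1 [<-] r0.
have lb0 : (`|b0| < (size x).+2)%N by move: r0; rewrite /inrange; lia.
pose o0 : pos x := Ordinal lb0.
have o0E : (nat_of_ord o0)%:Z = b0 by rewrite /=; move: r0; rewrite /inrange; lia.
apply/funext => q'; apply/funext => a'; apply/funext => b'.
rewrite /Ux (bigD1 q0) //= [X in _ + X]big1 ?addr0 => [|q nq]; last first.
  rewrite big1 // => c _; rewrite big1 // => d _; rewrite big1 // => b _.
  by rewrite /ket /= (negbTE nq) mulr0.
rewrite (bigD1 (mctr q')) //= [X in _ + X]big1 ?addr0 => [|c nc]; last first.
  rewrite big1 // => d _; rewrite big1 // => b _.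
  by rewrite /perm_delta [_ == c]eq_sym (negbTE nc) mul0r.
rewrite (bigD1 (mmov q')) //= [X in _ + X]big1 ?addr0 => [|d nd]; last first.
  rewrite big1 // => b _.
  by rewrite /perm_delta [_ == d]eq_sym (negbTE nd) andbF mul0r.
rewrite big_mkcond (bigD1 o0) //= [X in _ + X]big1 ?addr0 => [|b nb]; last first.
  case: ifP => // _; rewrite /ket /=.
  have /negbTE -> : (nat_of_ord b)%:Z != b0.
    apply: contra nb => /eqP e; apply/eqP/val_inj => /=; lia.
  by rewrite !andbF mulr0.
rewrite /ket /perm_delta /= !eqxx /=.
have pq1 : pi (tape x `|b0|%N) (a0 != 0) q0 = q1 by apply: piE; exact: eq1.
have -> : (`|b0|%N%:Z == b0) by move: r0; rewrite /inrange; lia.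
rewrite andbT.
case: (eqVneq (a' - mu (mctr q')) a0) => [ea|na]; last first.
  rewrite mulr0 if_same; case: ifP => // /and3P[/eqP e /eqP e2 _].
  by move: na; rewrite e2 e addrK eqxx.
rewrite /sgn ea pq1 mulr1.
case: (eqVneq q' q1) => [eq'|nq']; last by rewrite if_same.
subst q'.
have -> : a' == a0 + mu (mctr q1) by lia.
by rewrite hshift_inrange o0E // eq_sym.
Qed.

Lemma sqmod0 : sqmod 0 = 0. Proof. by rewrite /sqmod /= expr0n /= addr0. Qed.
Lemma sqmod1 : sqmod 1 = 1. Proof. by rewrite /sqmod /= expr0n /= addr0 expr1n. Qed.

Lemma sum_ket (H : {set mst M}) K c :
  inrange (size x).+1 c.2.2 -> - (K%:Z) <= c.2.1 <= K%:Z ->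
  \sum_(q in H) zsum K (fun a => \sum_(b : pos x) sqmod (ket c q a b)) =
  if c.1 \in H then 1 else 0.
Proof.
case: c => q0 [a0 b0] /= r0 ra.
have lb0 : (`|b0| < (size x).+2)%N by move: r0; rewrite /inrange; lia.
have la0 : (`|(a0 + K%:Z)%R| < (K.*2).+1)%N by lia.
pose o0 : pos x := Ordinal lb0.
pose i0 : 'I_(K.*2).+1 := Ordinal la0.
rewrite big_mkcond (bigD1 q0) //= [X in _ + X]big1 ?addr0 => [|q nq]; last first.
  case: ifP => // _; rewrite /zsum big1 // => i _; rewrite big1 // => b _.
  by rewrite /ket /= (negbTE nq) sqmod0.
case: ifP => // _; rewrite /zsum (bigD1 i0) //= [X in _ + X]big1 ?addr0 => [|i ni]; last first.
  rewrite big1 // => b _; rewrite /ket /=.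
  have /negbTE -> : (nat_of_ord i)%:Z - K%:Z != a0.
    apply: contra ni => /eqP e; apply/eqP/val_inj => /=; lia.
  by rewrite andbF sqmod0.
rewrite (bigD1 o0) //= [X in _ + X]big1 ?addr0 => [|b nb]; last first.
  rewrite /ket /=.
  have /negbTE -> : (nat_of_ord b)%:Z != b0.
    apply: contra nb => /eqP e; apply/eqP/val_inj => /=; lia.
  by rewrite !andbF sqmod0.
rewrite /ket /= eqxx.
have -> : (`|(a0 + K%:Z)%R|%N)%:Z - K%:Z == a0 by lia.
have -> : `|b0|%N%:Z == b0 by move: r0; rewrite /inrange; lia.
exact: sqmod1.
Qed.

Lemma ket_init : qinit perm_Q1CA x = ket (minit M).
Proof.
by apply/funext => q; apply/funext => a; apply/funext => b; rewrite /qinit /ket /= andbA.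
Qed.

Lemma proj_ket c : proj_non perm_Q1CA (ket c) =
  if macc c.1 || mrej c.1 then (fun _ _ _ => 0) else ket c.
Proof.
apply/funext => q; apply/funext => a; apply/funext => b; rewrite /proj_non /= !inE /ket.
by case hc: (macc c.1 || mrej c.1); case: (eqVneq q c.1) => [->|_]; rewrite ?hc //= if_same.
Qed.

Lemma live_before n k c c' : piter (step M y (size x).+1) n (minit M) = Some c ->
  (k < n)%N -> piter (step M y (size x).+1) k (minit M) = Some c' ->
  ~~ (macc c'.1 || mrej c'.1).
Proof.
move=> Hn lt_kn; have [z -> + [zc']] := piter_prefix (ltnW lt_kn) Hn; subst z.
rewrite -subn_gt0 in lt_kn; case: (n - k)%N lt_kn => //= j _.
by apply: contraPN => h; rewrite step_halt.
Qed.

Lemma qrun_ket n k c c' : piter (step M y (size x).+1) n (minit M) = Some c ->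
  (k < n)%N -> piter (step M y (size x).+1) k (minit M) = Some c' ->
  qrun perm_Q1CA x k = ket c'.
Proof.
move=> Hn; elim: k c' => [|k IH] c' lt_kn; first by case=> <-; exact: ket_init.
move=> Hk1; have := Hk1; rewrite piterSr.
case Hk : (piter _ _ _) => [d|//] /= st.
rewrite (IH d) 1?ltnW // (Ux_ket st) ?(piter_inrange Hk) ?init_inrange // proj_ket.
by rewrite (negbTE (live_before Hn lt_kn Hk1)).
Qed.

Lemma qrun_halted n k c : piter (step M y (size x).+1) n (minit M) = Some c ->
  macc c.1 || mrej c.1 -> (n <= k)%N -> qrun perm_Q1CA x k = fun _ _ _ => 0.
Proof.
move=> Hn hc /subnKC <-; elim: (k - n)%N => [|j IH]; last first.
  rewrite addnS /= IH; apply/funext => q; apply/funext => a; apply/funext => b.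
  rewrite /proj_non; case: ifP => // _; rewrite /Ux big1 // => q' _.
  by rewrite big1 // => c' _; rewrite big1 // => d _; rewrite big1 // => b' _; rewrite mulr0.
(* The initial state is not halting, so at least one step has been made. *)
case: n Hn => [|n] Hn.
  by move: Hn hc => [<-] /=; rewrite (negbTE (mini_live M)).
have := Hn; rewrite piterSr; case Hk : (piter _ _ _) => [d|//] /= st.
rewrite addn0 /= (qrun_ket Hn _ Hk) // (Ux_ket st).
  by rewrite proj_ket hc.
exact: piter_inrange Hk (init_inrange _ _).
Qed.

(** The state is a basis vector before the halting step and vanishes from then on, so all the
    probability sits in the measurement made after step [n]. *)
Lemma pstep_val (H : {set mst M}) n k c :
  (forall q, q \in H -> macc q || mrej q) ->
  piter (step M y (size x).+1) n (minit M) = Some c -> c.1 \in H ->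
  pstep perm_Q1CA x H k = if k.+1 == n then 1 else 0.
Proof.
move=> hH Hn cH; rewrite /pstep.
case: (ltnP k n) => [lt_kn|le_nk]; last first.
  rewrite (qrun_halted Hn) ?hH // gtn_eqF // /zsum.
  rewrite big1 // => q _; rewrite big1 // => i _; rewrite big1 // => b _.
  rewrite /Ux big1 ?sqmod0 // => q' _.
  by rewrite big1 // => c' _; rewrite big1 // => d _; rewrite big1 // => b' _; rewrite mulr0.
have [c' Hk1 _] := piter_prefix lt_kn Hn.
have := Hk1; rewrite piterSr; case Hk : (piter _ _ _) => [d|//] /= st.
rewrite (qrun_ket Hn lt_kn Hk) (Ux_ket st); last exact: piter_inrange Hk (init_inrange _ _).
rewrite sum_ket; last 2 first.
- exact: piter_inrange Hk1 (init_inrange _ _).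
- by have := piter_ctr Hk1; rewrite /= sub0r add0r.
case: (ltngtP k.+1 n) => [lt|gt|e].
- case: ifP => // /hH; by rewrite (negbTE (live_before Hn lt Hk1)).
- by move: lt_kn gt; lia.
- by subst n; move: Hn; rewrite Hk1 => -[->]; rewrite cH.
Qed.

Lemma halting_prob (H : {set mst M}) c :
  (forall q, q \in H -> macc q || mrej q) ->
  reach (step M y (size x).+1) (minit M) c -> c.1 \in H ->
  ((fun N => \sum_(k < N) pstep perm_Q1CA x H k : Rl) @ \oo --> (1 : Rl))%classic.
Proof.
move=> hH [n Hn] cH.
have n0 : (0 < n)%N.
  case: n Hn => // -[e]; move: (hH _ cH); rewrite -e /= (negbTE (mini_live M)).
  by [].
apply: cvg_near_cst; exists n => // N /= le_nN.
have lt : (n.-1 < N)%N by lia.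
rewrite (bigD1 (Ordinal lt)) //= (pstep_val _ hH Hn cH) prednK // eqxx big1 ?addr0 //.
move=> i ni; rewrite (pstep_val _ hH Hn cH); case: eqP => // e.
by case/eqP: ni; apply: val_inj => /=; lia.
Qed.

End Run.
End Quantum.

Lemma solvable_R1CA (Sigma : finType) (L : seq Sigma -> Prop) :
  solvable (fun x : seq Sigma => (size x).+1) (fun x b => tape x `|b|%N) L ->
  exists (Q' : finType) (M' : Q1CA Sigma Q'),
    is_R1CA M' /\ is_simple M' /\
    forall x : seq Sigma,
      (L x -> acc_prob_is M' x 1) /\ (~ L x -> rej_prob_is M' x 1).
Proof.
move=> [M [rM sM]].
have /choice [pi' pi'P] : forall gs : Gamma Sigma * bool, exists f : mst M -> mst M,
    injective f /\ forall q q', mdelta gs.1 gs.2 q = Some q' -> f q = q'.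
  move=> [g s]; have [f fi fE] := partial_inj_extend (rM g s).
  by exists f.
pose pi g s := pi' (g, s).
have pii g s : injective (pi g s) by case: (pi'P (g, s)).
have piE g s q q' : mdelta g s q = Some q' -> pi g s q = q'.
  by case: (pi'P (g, s)) => _; apply.
exists (mst M), (perm_Q1CA pii); split; first exact: perm_Q1CA_R1CA.
split=> [|x]; first exact: perm_Q1CA_simple.
split=> [/(sM x).1|/(sM x).2] [c rc hc]; apply: (halting_prob pii piE _ rc).
- by move=> q; rewrite inE => ->.
- by rewrite inE.
- by move=> q; rewrite inE => ->; rewrite orbT.
- by rewrite inE.
Qed.

(** * Labellings computed reversibly *)

Section Labels.
Context {A K : Type} (g : A -> K -> K) (s0 : K) (y : int -> A).

(** State of the automaton [g] after the letters strictly to the left of a cell; the letter of the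
    cell itself is not yet read. *)
Fixpoint lab (n : nat) : K := if n is n'.+1 then g (y n'%:Z) (lab n') else s0.

Definition label (b : int) : K := lab `|b|%N.

End Labels.

Section Navigation.
Context {A : Type} {K : finType} (g : A -> K -> K) (s0 : K) (lft : A -> bool).
Variable M : machine (A * K).

Definition isperm (a : A) : bool := injectiveb (g a).
Definition ginv (a : A) (k : K) : K := odflt s0 [pick t | g a t == k].

Hypothesis perm_or_cst : forall a k, ~~ isperm a -> g a k = g a s0.

Lemma ginvK a : isperm a -> cancel (g a) (ginv a).
Proof.
move/injectiveP => i k; rewrite /ginv; case: pickP => [t /eqP/i //|/(_ k)].
by rewrite eqxx.
Qed.

Lemma gK a : isperm a -> cancel (ginv a) (g a).
Proof.
move=> pa; have [h hK Kh] := injF_bij (injectiveP _ pa).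
by move=> k; rewrite -{1}(Kh k) ginvK // Kh.
Qed.

(** Eight phases. [tAct] has updated the counter and still owes the head move of [q]; [tArr] is
    where every right move lands before [tMain] resumes. *)
Definition navtag : finType := (bool * bool * bool)%type.
Definition navst : finType := (navtag * mst M * K)%type.
Local Notation tMain := ((false, false), false).
Local Notation tAct := ((false, false), true).
Local Notation tArr := ((false, true), false).
Local Notation tE := ((false, true), true).
Local Notation tRet := ((true, false), false).
Local Notation tLm := ((true, false), true).
Local Notation tRm := ((true, true), false).
Local Notation tEi := ((true, true), true).

(* In tMain and tAct the label k of the current cell is known.  Moving right over a
   letter acting as a constant must forget k: tE walks left, undoing permutations, until a
   constant letter or the left end determines k, and tRet returns.  Moving left over such
   a letter (tLm, tRm, tEi) is the inverse walk. *)
Definition nav_delta (a : A) (s : bool) (st : navst) : option navst :=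
  let: (t, q, k) := st in
  match t with
  | tMain => if mdelta (a, k) s q is Some q' then Some (tAct, q', k) else None
  | tAct =>
      if mmov q == tri0 then Some (tMain, q, k)
      else if mmov q == triR then
        if isperm a then Some (tArr, q, g a k)
        else if lft a then (if k == s0 then Some (tArr, q, g a k) else None)
        else Some (tE, q, k)
      else if lft a then None else Some (tLm, q, k)
  | tArr => if mmov q == triR then Some (tMain, q, k) else None
  | tE =>
      if isperm a then
        if lft a then (if ginv a k == s0 then Some (tRet, q, s0) else None)
        else Some (tE, q, ginv a k)
      else if k == g a s0 then Some (tRet, q, s0) else None
  | tRet =>
      if lft a || (k != s0) then None
      else if isperm a then Some (tRet, q, k) else Some (tArr, q, g a s0)
  | tLm =>
      if mmov q != triL then None
      else if isperm a then Some (tMain, q, ginv a k)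
      else if k == g a s0 then
        if lft a then Some (tMain, q, s0) else Some (tRm, q, s0)
      else None
  | tRm =>
      if k != s0 then None
      else if isperm a && ~~ lft a then Some (tRm, q, k) else Some (tEi, q, g a s0)
  | tEi =>
      if lft a || (mmov q != triL) then None
      else if isperm a then Some (tEi, q, g a k) else Some (tMain, q, k)
  end.

Definition nav_mov (st : navst) : tri :=
  match st.1.1 with
  | tMain | tAct => tri0
  | tArr | tRet | tEi => triR
  | tE | tLm | tRm => triL
  end.

Definition nav_ctr (st : navst) : tri :=
  if st.1.1 is tAct then mctr st.1.2 else tri0.

Definition nav_acc (st : navst) : bool := (st.1.1 == tMain) && macc st.1.2.
Definition nav_rej (st : navst) : bool := (st.1.1 == tMain) && mrej st.1.2.

Fact nav_live : ~~ (nav_acc (tMain, mini M, s0) || nav_rej (tMain, mini M, s0)).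
Proof. by rewrite /nav_acc /nav_rej /= (mini_live M). Qed.

Fact nav_acc_rej st : ~~ (nav_acc st && nav_rej st).
Proof.
apply/negP => /andP[/andP[_ h1] /andP[_ h2]].
by have := macc_rej st.1.2; rewrite h1 h2.
Qed.

Fact nav_halt a s st : nav_acc st || nav_rej st -> nav_delta a s st = None.
Proof.
case: st => [[t q] k]; rewrite /nav_acc /nav_rej /= -andb_orr => /andP[/eqP -> h].
by rewrite mhalt.
Qed.

Definition nav : machine A := Machine nav_ctr nav_mov nav_live nav_acc_rej nav_halt.

(** Whether the letter permutes labels, whether it is the left end and, for [tMain], the move of [q]
    tell apart the phases leading to a given phase. Within a phase the label is transported
    injectively or pinned to one value by a test. *)
Lemma nav_reversible : reversible M -> reversible nav.
Proof.
move=> rM a s [[t1 q1] k1] [[t2 q2] k2] [[t3 q3] k3] /=.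
have gi : isperm a -> injective (g a) by move/ginvK/can_inj.
have gvi : isperm a -> injective (ginv a) by move/gK/can_inj.
have nLR : triL <> triR by [].
have n0L : tri0 <> triL by [].
have n0R : tri0 <> triR by [].
case pa: (isperm a) gi gvi => gi gvi; case la: (lft a).
all: case: t1 => [[[] []] []] /=; rewrite ?pa ?la //=.
all: case: t2 => [[[] []] []] /=; rewrite ?pa ?la //=.
all: repeat (case: eqP => //= ?).
all: repeat match goal with |- context [match mdelta ?x ?y ?z with _ => _ end] =>
  let E := fresh "E" in case E: (mdelta x y z) => [?|] //= end.
all: intros; repeat match goal with
  H : Some _ = Some _ |- _ => injection H; clear H; intros; subst end.
all: try congruence.
all: try by congr (_, _); first [apply: (gi isT); congruence | apply: (gvi isT); congruence].
all: match goal with E1 : mdelta _ _ ?u = Some ?w, E2 : mdelta _ _ ?v = Some ?w |- (_, ?u, _) = _ =>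
  by rewrite (rM _ _ _ _ _ E1 E2) end.
Qed.

Section NavRun.
Variables (y : int -> A) (m : nat).
Hypothesis lftE : forall b, inrange m b -> lft (y b) = (b == 0).

Local Notation kap := (lab g s0 y).
Local Notation perm j := (isperm (y (j : nat)%:Z)).
Local Notation nreach := (reach (step nav y m)).
Local Notation cfg t q k a b := ((((t, q, k) : mst nav), (a, b)) : mst nav * place).

Lemma lftN (j : nat) : (j <= m)%N -> lft (y j%:Z) = (j == 0)%N.
Proof. by move=> r; rewrite lftE // /inrange; lia. Qed.

Lemma nav_step t q k t' q' k' a (j j' : nat) d :
  nav_delta (y j%:Z) (a != 0) (t, q, k) = Some (t', q', k') -> t' != tAct ->
  j'%:Z = j%:Z + mu (nav_mov (t', q', k')) -> (j' <= m)%N ->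
  nreach (cfg t' q' k' a j'%:Z) d -> nreach (cfg t q k a j%:Z) d.
Proof.
move=> e nt ej r; apply: (@reach_move _ nav) e _ ej _; last by rewrite /inrange; lia.
rewrite /= /nav_ctr /=; case: t' nt => [[[] []] []] //= _; rewrite mu_tri0; lia.
Qed.

Local Ltac side := solve [by [] | by rewrite /nav_mov /= ?mu_tri0 ?mu_triR ?mu_triL; lia | lia].

Lemma nav_E a q j : (j < m)%N ->
  exists2 j', (j' <= j)%N /\ (forall i, (j' < i <= j)%N -> perm i) &
    nreach (cfg tE q (kap j.+1) a j%:Z) (cfg tRet q s0 a j'.+1%:Z).
Proof.
elim: j => [|j IH] lt.
  exists 0%N; first by split=> // i; lia.
  apply: (nav_step _ _ _ _ (reach_refl _ _)); [|side..].
  rewrite /= lftN //; case: ifP => [pa|/negbT pa]; first by rewrite ginvK // eqxx.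
  by rewrite eqxx.
case pa: (perm j.+1); last first.
  exists j.+1; first by split=> // i; lia.
  apply: (nav_step _ _ _ _ (reach_refl _ _)); [|side..].
  by rewrite /= pa perm_or_cst ?pa // eqxx.
have [j' [le pj] rj] := IH (ltnW lt).
exists j'; first by split=> [|i ri]; [lia|have [->|] := eqVneq i j.+1; [|move=> ?; apply: pj; lia]].
apply: (nav_step _ _ _ _ rj); [|side..].
by rewrite /= lftN 1?ltnW // pa ginvK.
Qed.

(** The letter at [b] is the first non-permutation met on the way right, so the head finds its way
    back without remembering a distance. *)
Lemma nav_Ret a q j b : (0 < j <= b)%N -> (b < m)%N ->
  (forall i, (j <= i < b)%N -> perm i) -> ~~ perm b ->
  nreach (cfg tRet q s0 a j%:Z) (cfg tArr q (kap b.+1) a b.+1%:Z).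
Proof.
move=> rj ltb pj nb; have b0 : (b == 0)%N = false by lia.
elim: {j}(b - j)%N {-2}j (erefl (b - j)%N) rj pj => [|n IH] j e rj pj.
  have {e rj pj} -> : j = b by lia.
  apply: (nav_step _ _ _ _ (reach_refl _ _)); [|side..].
  by rewrite /= (negbTE nb) (perm_or_cst (kap b) nb) eqxx orbF lftN 1?ltnW // b0.
apply: nav_step (IH j.+1 _ _ _); [|side|side|side|lia|lia|by move=> i ri; apply: pj; lia].
have ltj : (j < m)%N by lia.
have pj' : perm j by apply: pj; lia.
by rewrite /= pj' eqxx orbF lftN 1?ltnW //; have -> : (j == 0)%N = false by lia.
Qed.

(** First half of the inverse walk: the head looks for the last cell behind which the label is
    known, and [nav_Ei] recomputes labels from there. *)
Lemma nav_Rm a q j : (j < m)%N ->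
  exists2 j', (j' <= j)%N /\ (forall i, (j' < i <= j)%N -> perm i) &
    nreach (cfg tRm q s0 a j%:Z) (cfg tEi q (kap j'.+1) a j'.+1%:Z).
Proof.
elim: j => [|j IH] lt.
  exists 0%N; first by split=> // i; lia.
  apply: (nav_step _ _ _ _ (reach_refl _ _)); [|side..].
  by rewrite /= lftN // eqxx andbF.
case pa: (perm j.+1); last first.
  exists j.+1; first by split=> // i; lia.
  apply: (nav_step _ _ _ _ (reach_refl _ _)); [|side..].
  by rewrite /= pa eqxx /= [in RHS]perm_or_cst // pa.
have [j' [le pj] rj] := IH (ltnW lt).
exists j'; first by split=> [|i ri]; [lia|have [->|] := eqVneq i j.+1; [|move=> ?; apply: pj; lia]].
apply: (nav_step _ _ _ _ rj); [|side..].
by rewrite /= lftN 1?ltnW // pa eqxx.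
Qed.

Lemma nav_Ei a q j b : mmov q = triL -> (0 < j <= b)%N -> (b <= m)%N ->
  (forall i, (j <= i < b)%N -> perm i) -> ~~ perm b ->
  nreach (cfg tEi q (kap j) a j%:Z) (cfg tMain q (kap b) a b%:Z).
Proof.
move=> mq rj ltb pj nb; have b0 : (b == 0)%N = false by lia.
elim: {j}(b - j)%N {-2}j (erefl (b - j)%N) rj pj => [|n IH] j e rj pj.
  have {e rj pj} -> : j = b by lia.
  apply: (nav_step _ _ _ _ (reach_refl _ _)); [|side..].
  by rewrite /= (negbTE nb) mq eqxx orbF lftN // b0.
apply: nav_step (IH j.+1 _ _ _); [|side|side|side|lia|lia|by move=> i ri; apply: pj; lia].
have ltj : (j <= m)%N by lia.
have pj' : perm j by apply: pj; lia.
by rewrite /= pj' mq eqxx orbF lftN //; have -> : (j == 0)%N = false by lia.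
Qed.

Definition nav_cfg (c : mst M * place) : mst nav * place :=
  ((tMain, c.1, label g s0 y c.2.2), c.2).

Lemma nav_right a q b : mmov q = triR -> (b < m)%N ->
  nreach (cfg tAct q (kap b) a b%:Z) (cfg tMain q (kap b.+1) a b.+1%:Z).
Proof.
move=> mq lt.
have fin : nreach (cfg tArr q (kap b.+1) a b.+1%:Z) (cfg tMain q (kap b.+1) a b.+1%:Z).
  by apply: (nav_step _ _ _ _ (reach_refl _ _)); [rewrite /= mq eqxx|side..].
case pb: (perm b).
  by apply: (nav_step _ _ _ _ fin); [rewrite /= mq pb ?tri_eqE ?eqxx|side..].
(* On cell 0 the label can only be [s0], so it is forgotten without a walk. *)
case: b pb lt fin => [|b] pb lt fin.
  by apply: (nav_step _ _ _ _ fin); [rewrite /= mq pb ?tri_eqE ?eqxx lftN // eqxx|side..].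
have [|j' [le pj] rj] := @nav_E a q b; first lia.
apply: (@nav_step _ _ _ tE q (kap b.+1) a _ b); [|side..|].
  by rewrite /= mq pb ?tri_eqE ?eqxx lftN // ltnW.
apply: (reach_trans rj); apply: (reach_trans _ fin).
apply: nav_Ret => //; last by rewrite pb.
Qed.

Lemma nav_left a q b : mmov q = triL -> (b < m)%N ->
  nreach (cfg tAct q (kap b.+1) a b.+1%:Z) (cfg tMain q (kap b) a b%:Z).
Proof.
move=> mq lt.
apply: (@nav_step _ _ _ tLm q (kap b.+1) a _ b); [|side..|].
  by rewrite /= mq ?tri_eqE lftN.
case pb: (perm b).
  by apply: (nav_step _ _ _ _ (reach_refl _ _)); [rewrite /= mq pb ?tri_eqE ?eqxx ginvK|side..].
have nb : ~~ perm b by rewrite pb.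
case: b pb nb lt => [|b] pb nb lt.
  apply: (nav_step _ _ _ _ (reach_refl _ _)); [|side..].
  by rewrite /= mq pb ?tri_eqE ?eqxx lftN // eqxx.
apply: (@nav_step _ _ _ tRm q s0 a _ b); [|side..|].
  by rewrite /= mq pb ?tri_eqE ?eqxx lftN 1?ltnW // (perm_or_cst _ nb) eqxx.
have [|j' [le pj] rj] := @nav_Rm a q b; first lia.
apply: (reach_trans rj).
by apply: nav_Ei => //; exact: ltnW.
Qed.

Lemma nav_sim c c' : inrange m c.2.2 ->
  step M (fun b => (y b, label g s0 y b)) m c = Some c' ->
  nreach (nav_cfg c) (nav_cfg c').
Proof.
case: c => q [a b] /= rb; rewrite /step /=.
case e: (mdelta _ _ _) => [q'|//]; case: ifP => //= rb' [<-].
apply: (@reach_move _ nav _ _ _ _ _ (tAct, q', label g s0 y b) (a + mu (mctr q')) b) => //=.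
- by move: e; rewrite /sigd /= => ->.
- by rewrite mu_tri0 addr0.
rewrite /nav_cfg /shift /=; move: rb rb' {e}; set a' := a + _.
case: b => [b|//] rb rb'; rewrite /label /=.
have [mq|mq|mq] := triP (mmov q'); move: rb'; rewrite mq ?mu_triL ?mu_tri0 ?mu_triR => rb'.
- case: b rb rb' => [|b] rb rb'; first by [].
  have -> : b.+1%:Z + -1 = b%:Z by lia.
  by apply: nav_left => //; move: rb; rewrite /inrange; lia.
- rewrite addr0; apply: (nav_step _ _ _ _ (reach_refl _ _)); [|side..].
  by rewrite /= mq.
- have -> : b%:Z + 1 = b.+1%:Z by lia.
  by apply: nav_right => //; move: rb'; rewrite /inrange; lia.
Qed.

Lemma nav_reach c c' : inrange m c.2.2 ->
  reach (step M (fun b => (y b, label g s0 y b)) m) c c' ->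
  nreach (nav_cfg c) (nav_cfg c').
Proof.
move=> + [n]; elim: n c => [|n IH] c rc /=; first by case=> ->; exact: reach_refl.
case e: (step _ _ _ c) => [d|//] /= /IH H.
exact: reach_trans (nav_sim rc e) (H (step_inrange e)).
Qed.

End NavRun.
End Navigation.

Section Annotation.
Context {X : Type} (m : X -> nat).

Definition annotate {A K : Type} (T : X -> int -> A) (kap : X -> int -> K) :=
  fun x b => (T x b, kap x b).

Definition left_marked {A : Type} (T : X -> int -> A) : Prop :=
  exists lft : A -> bool, forall x b, inrange (m x) b -> lft (T x b) = (b == 0).

(** Stated as a transfer of solvability rather than through a machine producing the labels, so that
    labellings compose at once. *)
Definition computable {A K : Type} (T : X -> int -> A) (kap : X -> int -> K) : Prop :=
  forall L, solvable m (annotate T kap) L -> solvable m T L.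

Lemma perm_cst_computable A (K : finType) (T : X -> int -> A) (g : A -> K -> K) s0 :
  left_marked T -> (forall a k, ~~ injectiveb (g a) -> g a k = g a s0) ->
  computable T (fun x => label g s0 (T x)).
Proof.
move=> [lft lE] gP L [M [rM sM]]; exists (nav g s0 lft M); split.
  exact: nav_reversible rM.
move=> x; split=> [/(sM x).1|/(sM x).2] [c rc hc];
  by exists (nav_cfg g s0 lft (T x) c);
    [exact: (nav_reach gP (lE x) (init_inrange M (m x)) rc)|rewrite /= ?/nav_acc ?/nav_rej /= hc].
Qed.

End Annotation.

(** * Labellings by arbitrary finite automata, reduced to permutations and constants *)

Section KrohnRhodes.
Context {X : Type} (m : X -> nat).

Lemma eq_computable A K (T : X -> int -> A) (k1 k2 : X -> int -> K) :
  (forall x b, inrange (m x) b -> k1 x b = k2 x b) ->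
  computable m T k1 -> computable m T k2.
Proof.
move=> e c L h; apply: c; apply: (solvable_relabel (h := id)) h => x b r.
by rewrite /annotate (e _ _ r).
Qed.

Lemma left_marked_annotate A K (T : X -> int -> A) (kap : X -> int -> K) :
  left_marked m T -> left_marked m (annotate T kap).
Proof. by move=> [lft lE]; exists (fun a => lft a.1). Qed.

Lemma computable_map A B K (T : X -> int -> A) (u : X -> int -> B) (k : X -> int -> K)
    (h : A -> B -> K) :
  (forall x b, inrange (m x) b -> k x b = h (T x b) (u x b)) ->
  computable m T u -> computable m T k.
Proof.
move=> e c L s; apply: c.
apply: (solvable_relabel (h := fun ab => (ab.1, h ab.1 ab.2))) s => x b r.
by rewrite /annotate /= e.
Qed.

Lemma computable_pair A B K (T : X -> int -> A) (u : X -> int -> B) (k : X -> int -> K) :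
  computable m T u -> computable m (annotate T u) k ->
  computable m T (fun x b => (u x b, k x b)).
Proof.
move=> cu ck L s; apply/cu/ck.
by apply: (solvable_relabel (h := fun p => (p.1.1, (p.1.2, p.2)))) s.
Qed.

Lemma label_next A (K : Type) (g : A -> K -> K) s0 (y : int -> A) (n : nat) :
  label g s0 y n.+1%:Z = g (y n%:Z) (label g s0 y n%:Z).
Proof. by []. Qed.

(** The set [H] confines the maps by which letters act, so that its number of bad members can serve
    as an induction measure. *)
Definition dfa_computable (K : finType) (H : {set {ffun K -> K}}) : Prop :=
  forall A (T : X -> int -> A) (g : A -> {ffun K -> K}) s0, left_marked m T ->
  (forall a, g a \in H) -> computable m T (fun x => label (fun a => g a) s0 (T x)).

(** Neither a permutation nor constant: the maps that the walks of [nav] cannot treat. *)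
Definition bad (K : finType) (f : {ffun K -> K}) : bool :=
  ~~ injectiveb f && [exists k, exists k', f k != f k'].

Lemma label_comp A A' (K : Type) (g : A -> K -> K) s0 (y : int -> A) (y' : int -> A') h :
  (forall b, y b = h (y' b)) -> label g s0 y =1 label (fun a => g (h a)) s0 y'.
Proof. by move=> e b; rewrite /label; elim: (`|b|)%N => //= n ->; rewrite e. Qed.

(** The labellings are computed one after another, each on a tape already annotated by others; hence
    the hypothesis ranges over all refinements [T'] of [T]. *)
Lemma computable_all (K I : finType) (k0 : K) A (T : X -> int -> A) (k : I -> X -> int -> K) :
  (forall i A' (T' : X -> int -> A') (h : A' -> A), left_marked m T' ->
     (forall x b, T x b = h (T' x b)) -> computable m T' (k i)) ->
  left_marked m T ->
  computable m T (fun x b => [ffun i => k i x b]).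
Proof.
move=> ck mT.
have H (l : seq I) : forall A' (T' : X -> int -> A') (h : A' -> A), left_marked m T' ->
     (forall x b, T x b = h (T' x b)) -> computable m T' (fun x b => [seq k i x b | i <- l]).
  elim: l => [|i l IH] A' T' h mT' hT'.
    by move=> L; apply: (solvable_relabel (h := fun a => (a, [::]))).
  apply: (@computable_map _ (K * seq K)%type _ _ (fun x b => (k i x b, [seq k i x b | i <- l])) _
    (fun _ p => p.1 :: p.2)) => //.
  apply: computable_pair; first exact: ck hT'.
  by apply: (IH _ _ (fun a => h a.1)); [exact: left_marked_annotate|].
apply: (computable_map (h := fun _ s => [ffun i => nth k0 s (enum_rank i)]))
  (H (enum I) _ T id mT _) => // x b _.
apply/ffunP => i; rewrite !ffunE (nth_map i) ?nth_enum_rank //.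
by rewrite -cardE ltn_ord.
Qed.

(** Induction on the number of labels, then on the number of bad maps. For a bad [h], a label is the
    value just after the last letter acting by [h], transported by the letters since. The transport
    uses fewer bad maps, and the value lies in the image of [h], which is smaller than [K]. *)
Lemma dfa_computable_le n j (K : finType) (H : {set {ffun K -> K}}) :
  (#|K| <= n)%N -> (#|H :&: finset (@bad K)| <= j)%N -> dfa_computable H.
Proof.
elim: n j K H => [|n IHn] j K H cK; first by
  move=> _ A T g s0; move: cK; rewrite leqn0 => /eqP/card0_eq/(_ s0); rewrite inE.
elim: j H => [|j IHj] H cH A T g s0 mT gH.
  apply: perm_cst_computable => // a k ni.
  have : g a \notin H :&: finset (@bad K).
    by move: cH; rewrite leqn0 cards_eq0 => /eqP ->; rewrite inE.
  rewrite !inE gH /= /bad ni /= negb_exists => /forallP /(_ k).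
  by rewrite negb_exists => /forallP /(_ s0); rewrite negbK => /eqP.
have [h0|[h]] := set_0Vmem (H :&: finset (@bad K)).
  by apply: (IHj H) => //; rewrite h0 cards0.
rewrite !inE => /andP[hH hb].
pose c a := g a == h.
pose seen x := label (fun a v => v || c a) false (T x).
pose gs s a : {ffun K -> K} := if c a then [ffun _ => s] else g a.
pose H' s := [ffun _ => s] |: (H :\ h).
have H'j s : (#|H' s :&: finset (@bad K)| <= j)%N.
  rewrite -ltnS; apply: leq_trans cH; apply: proper_card; apply/properP; split.
    apply/fintype.subsetP => f; rewrite !inE => /andP[/orP[/eqP ->|/andP[_ ->] //]].
    by rewrite /bad => /andP[_ /existsP[k /existsP[k']]]; rewrite !ffunE eqxx.
  exists h; rewrite !inE ?hH ?hb //= eqxx orbF andbT.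
  apply/negP => /eqP e; move: hb; rewrite e.
  by rewrite /bad => /andP[_ /existsP[k /existsP[k']]]; rewrite !ffunE eqxx.
(* Replacing [h] by the constant [s] restarts the automaton in [s] at each such letter, so [U x b]
   is the action of the letters read since the last one. *)
pose U x b := [ffun s => label (fun a => gs s a) s (T x) b].
have cseen : computable m T seen.
  apply: perm_cst_computable => // a k; rewrite /c; case: eqP => [_ _|_]; first by rewrite !orbT.
  by move/injectiveP => []; move=> u v; rewrite !orbF.
have cU B (v : X -> int -> B) : computable m (annotate T v) U.
  apply: (@computable_all K K s0); last exact: left_marked_annotate.
  move=> s A' T' h' mT' hT'.
  apply: (@eq_computable _ _ T' (fun x => label (fun a => gs s (h' a).1) s (T' x))).
    move=> x b _; rewrite (@label_comp _ _ _ _ _ _ (T' x) (fun a => (h' a).1)) // => b'.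
    by rewrite -hT'.
  apply: (IHj (H' s)) => // a; rewrite /gs /c !inE.
  by case: (eqVneq (g (h' a).1) h) => [_|ne]; rewrite ?eqxx // ne gH orbT.
pose K' : finType := {t : K | t \in codom h}.
pose hK k : K' := Sub (h k) (codom_f h k).
(* At a letter acting by [h] the old label is rebuilt from the annotation and [h] is applied; other
   letters keep the value. The start [hK s0] is a dummy, read only once [seen] holds. *)
pose g3 (a : A * (bool * {ffun K -> K})) : {ffun K' -> K'} :=
  if c a.1 then if a.2.1 then [ffun t => hK (a.2.2 (val t))] else [ffun _ => hK (a.2.2 s0)]
  else [ffun t => t].
pose T2 := annotate T (fun x b => (seen x b, U x b)).
pose t x := label (fun a => g3 a) (hK s0) (T2 x).
have ct : computable m T2 t.
  apply: (IHn _ K' finset.setT _ (leqnn _));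
    [|exact: left_marked_annotate|by move=> a; rewrite inE].
    rewrite card_sig; rewrite -ltnS; apply: leq_trans cK.
    rewrite ltn_neqAle max_card andbT; apply: contraNN (proj1 (andP hb)) => /eqP e.
    have /fintype.image_injP i : #|codom h| == #|K| by apply/eqP.
    by apply/injectiveP => u v; apply: i.
have cS : computable m T (fun x b => (seen x b, U x b)) by apply: computable_pair.
have E x n' : label (fun a => g a) s0 (T x) n'%:Z =
    U x n'%:Z (if seen x n'%:Z then val (t x n'%:Z) else s0).
  elim: n' => [|n' IH]; first by rewrite /U ffunE.
  rewrite label_next IH /seen /t /U !ffunE !label_next -/(seen x) -/(t x).
  rewrite /gs /g3 /=; case cc: (c (T x n')); last by rewrite !orbF !ffunE.
  rewrite orbT !ffunE (eqP cc).
  by case: (seen x n'); rewrite ffunE //= /U ffunE.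
apply: (@computable_map _ _ _ T (fun x b => ((seen x b, U x b), t x b)) _
  (fun _ p => p.1.2 (if p.1.1 then val p.2 else s0))); last exact: computable_pair cS ct.
by move=> x [b|b] //= _; rewrite E.
Qed.

Lemma dfa_label_computable (K : finType) A (T : X -> int -> A) (g : A -> K -> K) s0 :
  left_marked m T -> computable m T (fun x => label g s0 (T x)).
Proof.
move=> mT; pose g' a : {ffun K -> K} := [ffun k => g a k].
apply: (@eq_computable _ _ _ (fun x => label (fun a => g' a) s0 (T x))).
  by move=> x b _; rewrite /label; elim: (`|b|)%N => //= n ->; rewrite ffunE.
by apply: (@dfa_computable_le _ _ _ finset.setT (leqnn _) (leqnn _)) => // a; rewrite inE.
Qed.

End KrohnRhodes.

(** * Euler tours of the ancestors of a configuration *)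

Section EulerTour.
Local Arguments onth : simpl never.
Context {St : finType}.

Definition children (f : St -> option St) (q : St) : seq St :=
  [seq r <- enum St | f r == Some q].

(* [inl q]: the subtree of q has been explored; [inr r]: it is about to be. *)
Definition eul (f : St -> option St) (d : St + St) : option (St + St) :=
  match d with
  | inl q =>
      if f q is Some q' then
        Some (if onth (children f q') (index q (children f q')).+1 is Some r
              then inr r else inl q')
      else None
  | inr r => Some (if ohead (children f r) is Some t then inr t else inl r)
  end.

Lemma mem_children f q r : (r \in children f q) = (f r == Some q).
Proof. by rewrite mem_filter mem_enum andbT. Qed.

Lemma uniq_children f q : uniq (children f q).
Proof. by rewrite filter_uniq ?enum_uniq. Qed.

Lemma onth_index (s : seq St) i r : uniq s -> onth s i = Some r ->
  (i < size s)%N /\ index r s = i.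
Proof.
move=> us e; have lt : (i < size s)%N by rewrite -onthTE e.
have <- : nth r s i = r by exact: onth_nth e.
by rewrite index_uniq.
Qed.

Lemma index_last (s : seq St) r : r \in s -> onth s (index r s).+1 = None ->
  (index r s).+1 = size s.
Proof.
by move=> rs e; apply/eqP; rewrite eqn_leq index_mem rs -onthNE e.
Qed.

(** The predecessor of [inr r] is the previous sibling of [r], done, or the descent from its parent
    if [r] comes first; that of [inl q] is its last child, done, or [inr q] if [q] is a leaf. *)
Lemma eul_inj f d1 d2 d : eul f d1 = Some d -> eul f d2 = Some d -> d1 = d2.
Proof.
have headP q t : ohead (children f q) = Some t -> f t = Some q /\ index t (children f q) = 0%N.
  case e: (children f q) => [//|u l] [<-]; split; last by rewrite /= eqxx.
  by apply/eqP; rewrite -mem_children e mem_head.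
have nextP q q' r : f q = Some q' -> onth (children f q') (index q (children f q')).+1 = Some r ->
    f r = Some q' /\ index r (children f q') = (index q (children f q')).+1.
  move=> fq e; have [lt <-] := onth_index (uniq_children _ _) e; split=> //.
  by apply/eqP; rewrite -mem_children; apply/onthP; exists (index q (children f q')).+1.
have mixed q1 r2 : eul f (inl q1) = Some d -> eul f (inr r2) = Some d -> False.
  rewrite /eul; case fq: (f q1) => [q'|//]; case e1: (onth (children f q') _) => [r|];
    case e2: (ohead _) => [t|] // [<-] // [].
    move=> tr; subst t; have [f1 i1] := nextP _ _ _ fq e1; have [f2 i2] := headP _ _ e2.
    by move: f1; rewrite f2 => -[rq]; subst q'; rewrite i2 in i1.
  move=> rq; subst r2; have : q1 \in children f q' by rewrite mem_children fq.
  by case: (children f q') e2.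
case: d1 => [q1|r1]; case: d2 => [q2|r2]; 
  try by move=> h1 h2; first [case: (mixed _ _ h1 h2) | case: (mixed _ _ h2 h1)].
- rewrite /eul; case f1: (f q1) => [q1'|//]; case f2: (f q2) => [q2'|//].
  case e1: (onth (children f q1') _) => [s1|]; case e2: (onth (children f q2') _) => [s2|];
    move=> -[<-] // [] e; [subst s2|subst q2'].
    have [g1 i1] := nextP _ _ _ f1 e1; have [g2 i2] := nextP _ _ _ f2 e2.
    move: g2; rewrite g1 => -[qq]; subst q2'; move: i2; rewrite i1 => -[] ii.
    by congr inl; apply: (index_inj q1) ii; rewrite mem_children ?f1 ?f2.
  have m1 : q1 \in children f q1' by rewrite mem_children f1.
  have m2 : q2 \in children f q1' by rewrite mem_children f2.
  have := index_last m1 e1; rewrite -(index_last m2 e2) => -[] ii.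
  by congr inl; apply: (index_inj q1) ii.
- rewrite /eul; case e1: (ohead (children f r1)) => [s1|];
    case e2: (ohead (children f r2)) => [s2|] => -[<-] // [] e; [subst s2|by rewrite e].
  by have [g1 _] := headP _ _ e1; have [] := headP _ _ e2; rewrite g1 => -[->].
Qed.

Context {Pos : Type} (phi : Pos -> St -> option St) (mv mvi : St -> Pos -> Pos).
Hypotheses (mvK : forall q, cancel (mv q) (mvi q)) (mviK : forall q, cancel (mvi q) (mv q)).
Variable stop : pred Pos.

(** [inl q] stands on the place of [q] itself, [inr r] on the place from which [r] is entered, where
    [phi] shows the children of [r]. *)
Definition dmv (d : St + St) (p : Pos) : Pos :=
  match d with inl q => mv q p | inr r => mvi r p end.

Definition astep (c : St * Pos) : option (St * Pos) :=
  omap (fun q' => (q', mv q' c.2)) (phi c.2 c.1).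

Definition estep (c : (St + St) * Pos) : option ((St + St) * Pos) :=
  omap (fun d => (d, dmv d c.2)) (eul (phi c.2) c.1).

Definition sstep (c : (St + St) * Pos) : option ((St + St) * Pos) :=
  if c.1 is inr _ then if stop c.2 then None else estep c else estep c.

(** The two outcomes of exploring the ancestors of [(q, p)]: [stopped] finds one that is entered
    from a stop place, [toured] comes back having met none. *)
Definition stopped (q : St) (p : Pos) : Prop :=
  exists r' p', [/\ reach sstep (inr q, mvi q p) (inr r', p'), stop p' &
    reach astep (r', mv r' p') (q, p)].

Definition toured (q : St) (p : Pos) : Prop :=
  reach sstep (inr q, mvi q p) (inl q, p) /\
  forall e, reach astep e (q, p) -> ~~ stop (mvi e.1 e.2).

Lemma tour_siblings q p i t :
  (forall r, r \in children (phi p) q -> stopped r p \/ toured r p) ->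
  onth (children (phi p) q) i = Some t ->
  (exists r' p', [/\ reach sstep (inl t, p) (inr r', p'), stop p' &
     reach astep (r', mv r' p') (q, mv q p)]) \/
  (reach sstep (inl t, p) (inl q, mv q p) /\
   forall j r, (i < j)%N -> onth (children (phi p) q) j = Some r -> toured r p).
Proof.
set l := children _ _ => H.
elim: {i}(size l - i)%N {-2}i (erefl (size l - i)%N) t => [|n IH] i e t ti.
  by have [] := onth_index (uniq_children _ _) ti; rewrite -/l; lia.
have [lt it] := onth_index (uniq_children _ _) ti; rewrite -/l in lt it.
have tq : phi p t = Some q by apply/eqP; rewrite -mem_children; apply/onthP; exists i.
case ni: (onth l i.+1) => [r|]; last first.
  right; split; last first.
    move=> j r lij /(onth_index (uniq_children _ _)) []; rewrite -/l => ltj _.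
    by have := onthNE l i.+1; rewrite ni /=; lia.
  by apply: reach_step; rewrite /sstep /= /estep /= tq -/l it ni.
have st : sstep (inl t, p) = Some (inr r, mvi r p).
  by rewrite /sstep /= /estep /= tq -/l it ni.
have rq : r \in l by apply/onthP; exists i.+1.
have ar : astep (r, p) = Some (q, mv q p).
  by move: rq; rewrite mem_children /astep /= => /eqP ->.
have [[r' [p' [h1 h2 h3]]]|[h1 h2]] := H r rq.
  left; exists r', p'; split=> //; first exact: reach_next st h1.
  exact: reach_trans h3 (reach_step ar).
have [|[r' [p' [g1 g2 g3]]]|[g1 g2]] := IH i.+1 _ r ni; first by lia.
  by left; exists r', p'; split=> //; apply: reach_next st (reach_trans h1 g1).
right; split; first by apply: reach_next st (reach_trans h1 g1).
move=> j u ltij uj; have [e'|ne] := eqVneq j i.+1; last by apply: g2 uj; lia.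
by move: uj; rewrite e' ni => -[<-].
Qed.

(** Induction on the bound [n] for the length of ancestor chains; [key] handles one level, visiting
    the first child and then its siblings. *)
Lemma tour_subtree n q p :
  (forall k e, piter astep k e = Some (q, p) -> (k <= n)%N) -> stopped q p \/ toured q p.
Proof.
have key u v : (forall r, r \in children (phi (mvi u v)) u ->
    stopped r (mvi u v) \/ toured r (mvi u v)) -> stopped u v \/ toured u v.
  move=> H; have [sv|nsv] := boolP (stop (mvi u v)).
    by left; exists u, (mvi u v); rewrite mviK; split=> //; exact: reach_refl.
  have par e : astep e = Some (u, v) -> e.2 = mvi u v /\ e.1 \in children (phi (mvi u v)) u.
    case: e => r w; rewrite /astep /=; case fr: (phi w r) => [r'|] //= -[e1 e2].
    by rewrite -e2 -e1 mvK; split=> //; rewrite mem_children fr.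
  case c0: (ohead (children (phi (mvi u v)) u)) => [t|]; last first.
    right; split.
      by apply: reach_step; rewrite /sstep /= (negbTE nsv) /estep /= c0 /= mviK.
    move=> e re; have [->//|[d _ pd]] := reach_last re.
    move: (par _ pd).2.
    by case: (children (phi (mvi u v)) u) c0.
  have st : sstep (inr u, mvi u v) = Some (inr t, mvi t (mvi u v)).
    by rewrite /sstep /= (negbTE nsv) /estep /= c0.
  have t0 : onth (children (phi (mvi u v)) u) 0 = Some t by case: (children (phi (mvi u v)) u) c0.
  have tc : t \in children (phi (mvi u v)) u by apply/onthP; exists 0%N.
  have ast r : r \in children (phi (mvi u v)) u -> astep (r, mvi u v) = Some (u, v).
    by rewrite mem_children /astep /= => /eqP ->; rewrite /= mviK.
  have [[r' [p' [h1 h2 h3]]]|tt] := H t tc.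
    left; exists r', p'; split=> //; first exact: reach_next st h1.
    exact: reach_trans h3 (reach_step (ast _ tc)).
  have [[r' [p' [h1 h2 h3]]]|[h1 h2]] := tour_siblings H t0.
    left; exists r', p'; split=> //; last by rewrite mviK in h3.
    exact: reach_next st (reach_trans tt.1 h1).
  rewrite mviK in h1; right; split; first exact: reach_next st (reach_trans tt.1 h1).
  move=> e re; have [-> //|[[r w] er pd]] := reach_last re.
  have /= [wE rc] := par _ pd; rewrite {}wE in er.
  have /onthP [[|j] ej] := rc; last by apply: (h2 _ _ _ ej).2 er.
  by move: ej; rewrite t0 => -[tr]; subst t; apply: tt.2 er.
elim: n q p => [|n IH] q p H; apply: key => r rc.
all: have ar : astep (r, mvi q p) = Some (q, p)
  by move: rc; rewrite mem_children /astep /= => /eqP ->; rewrite /= mviK.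
  by have := H 1%N (r, mvi q p); rewrite /= ar => /(_ erefl).
by apply: IH => k e ek; rewrite -ltnS; apply: (H k.+1 e); rewrite piterSr ek.
Qed.

End EulerTour.

(** * Machines whose nonzero graph is acyclic *)

Definition nzstep {A : Type} (M : machine A) (y : int -> A) (m : nat)
    (c : mst M * int) : option (mst M * int) :=
  if inrange m c.2 then
    if mdelta (y c.2) true c.1 is Some q then
      if inrange m (c.2 + mu (mmov q)) then Some (q, c.2 + mu (mmov q)) else None
    else None
  else None.
Arguments nzstep {A} M y m c.

Section Reversal.
Context {A : Type} (M : machine A) (lft rgt : A -> bool).

(* States that cannot be entered at an end of the tape, or would leave it, are blocked,
   so that backward exploration remains on the tape. *)
Definition okin (a : A) (q : mst M) : bool :=
  ~~ (lft a && (mmov q == triR)) && ~~ (rgt a && (mmov q == triL)).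
Definition okout (a : A) (q : mst M) : bool :=
  ~~ (lft a && (mmov q == triL)) && ~~ (rgt a && (mmov q == triR)).

Definition gdelta (a : A) (s : bool) (q : mst M) : option (mst M) :=
  if mdelta a s q is Some q' then if okin a q && okout a q' then Some q' else None
  else None.

Definition guarded : Prop := forall a s q q',
  mdelta a s q = Some q' -> okin a q && okout a q'.

Lemma gdelta_guarded a s q : guarded -> gdelta a s q = mdelta a s q.
Proof. by move=> g; rewrite /gdelta; case e: mdelta => [q'|//]; rewrite (g _ _ _ _ e). Qed.

Definition tour_delta (a : A) (s : bool) := eul (gdelta a s).
Definition tour_ctr (d : mst M + mst M) : tri :=
  match d with inl q => mctr q | inr r => tneg (mctr r) end.
Definition tour_mov (d : mst M + mst M) : tri :=
  match d with inl q => mmov q | inr r => tneg (mmov r) end.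
Definition tour_acc (d : mst M + mst M) : bool := if d is inl q then macc q else false.
Definition tour_rej (d : mst M + mst M) : bool := if d is inl q then mrej q else false.

Fact tour_live : ~~ (tour_acc (inl (mini M)) || tour_rej (inl (mini M))).
Proof. exact: mini_live. Qed.
Fact tour_acc_rej d : ~~ (tour_acc d && tour_rej d).
Proof. by case: d => //= q; exact: macc_rej. Qed.
Fact tour_halt a s d : tour_acc d || tour_rej d -> tour_delta a s d = None.
Proof. by case: d => //= q h; rewrite /gdelta mhalt. Qed.

Definition tour : machine A := Machine tour_ctr tour_mov tour_live tour_acc_rej tour_halt.

Lemma tour_reversible : reversible tour.
Proof. by move=> a s d1 d2 d; exact: eul_inj. Qed.

Section TourRun.
Variables (y : int -> A) (m : nat).
Hypothesis lftE : forall b, inrange m b -> lft (y b) = (b == 0).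
Hypothesis rgtE : forall b, inrange m b -> rgt (y b) = (b == m%:Z).

Definition tphi (p : place) : mst M -> option (mst M) :=
  if inrange m p.2 then gdelta (y p.2) (sigd p) else fun _ => None.

Local Notation ast := (astep tphi (@shift A M)).
Local Notation est := (estep tphi (@shift A M) (@unshift A M)).

Lemma okin_inrange q b : inrange m b -> okin (y b) q = inrange m (b - mu (mmov q)).
Proof.
move=> r; rewrite /okin lftE // rgtE //; move: r; rewrite /inrange.
by have [->|->|->] := triP (mmov q); rewrite ?mu_triL ?mu_triR ?mu_tri0 ?tri_eqE ?eqxx /=; lia.
Qed.

Lemma okout_inrange q b : inrange m b -> okout (y b) q = inrange m (b + mu (mmov q)).
Proof.
move=> r; rewrite /okout lftE // rgtE //; move: r; rewrite /inrange.
by have [->|->|->] := triP (mmov q); rewrite ?mu_triL ?mu_triR ?mu_tri0 ?tri_eqE ?eqxx /=; lia.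
Qed.

Lemma astepE c : ast c =
  if inrange m c.2.2 && inrange m (c.2.2 - mu (mmov c.1)) then step M y m c else None.
Proof.
case: c => q p; rewrite /astep /tphi /step /=; case: ifP => //= r.
rewrite /gdelta; case: mdelta => [q'|]; last by rewrite if_same.
rewrite okin_inrange // okout_inrange //.
by case: (inrange _ (_ - _)) => //=; case: ifP.
Qed.

(** A dart [inr r] stands one backward move away from the cell of [r]; both cells have to lie on the
    tape. *)
Definition good (c : mst tour * place) : bool :=
  inrange m c.2.2 && (if c.1 is inr r then inrange m (c.2.2 + mu (mmov r)) else true).

Lemma est_step c c' : good c -> est c = Some c' -> step tour y m c = Some c' /\ good c'.
Proof.
case: c => d p; rewrite /good /= => /andP[r rd]; rewrite /estep /step /= /tphi r.
rewrite /tour_delta; case e: (eul _ d) => [d'|] //= [<-].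
have -> : shift (M := tour) d' p = dmv (@shift A M) (@unshift A M) d' p.
  by case: d' {e} => q; rewrite /= /shift /unshift /= ?mu_tneg.
suff gd : inrange m (dmv (@shift A M) (@unshift A M) d' p).2 &&
    (if d' is inr r'
     then inrange m ((dmv (@shift A M) (@unshift A M) d' p).2 + mu (mmov r')) else true).
  rewrite /= gd; have /andP[h _] := gd; split=> //.
  suff -> : p.2 + mu (tour_mov d') = (dmv (@shift A M) (@unshift A M) d' p).2 by rewrite h.
  by case: d' {e gd h} => q; rewrite /= ?mu_tneg.
have chd q' t : t \in children (gdelta (y p.2) (sigd p)) q' -> inrange m (p.2 - mu (mmov t)).
  rewrite mem_children /gdelta; case: mdelta => // q1; rewrite okin_inrange //.
  by case: (inrange _ _).
have fwd q q' : gdelta (y p.2) (sigd p) q = Some q' -> inrange m (p.2 + mu (mmov q')).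
  rewrite /gdelta; case: mdelta => // q1; rewrite okout_inrange //.
  by case: ifP => // /andP[_ h] [<-].
case: d e rd => [q|t]; rewrite /eul.
  case gq: (gdelta _ _ q) => [q'|//].
  case n: (onth (children (gdelta (y p.2) (sigd p)) q') _) => [t|] [<-] _ /=.
    rewrite subrK r andbT; apply: (chd q'); apply/onthP.
    by exists (index q (children (gdelta (y p.2) (sigd p)) q')).+1.
  by rewrite (fwd _ _ gq).
case n: (ohead (children (gdelta (y p.2) (sigd p)) t)) => [u|] [<-] rt /=; last by rewrite rt.
rewrite subrK r andbT; apply: (chd t).
by case: (children (gdelta (y p.2) (sigd p)) t) n => // v l [->]; rewrite mem_head.
Qed.

Lemma est_reach c c' : good c -> reach est c c' -> reach (step tour y m) c c'.
Proof.
move=> + [n]; elim: n c => [|n IH] c gc /=; first by case=> ->; exact: reach_refl.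
case e: (est c) => [d|//] /= h; have [st gd] := est_step gc e.
exact: reach_next st (IH _ gd h).
Qed.

(** The initial state has a stationary move, so it too counts as entered from a cell of the tape. *)
Lemma arrival c : mmov (mini M) = tri0 -> reach (step M y m) (minit M) c ->
  inrange m c.2.2 /\ inrange m (c.2.2 - mu (mmov c.1)).
Proof.
move=> mv0 rc; have r := reach_inrange rc (init_inrange _ _); split=> //.
have [<-|[d rd]] := reach_last rc; first by rewrite /= mv0 mu_tri0 /inrange; lia.
have := reach_inrange rd (init_inrange _ _).
rewrite /step; case: mdelta => // q r'; case: ifP => //= _ [<-] /=.
by rewrite addrK.
Qed.

Hypothesis acyclic : forall c, ~ recurrent (nzstep M y m) c.

Let N := (#|mst M| * m.+1)%N.

Lemma ast_inrange c c' : ast c = Some c' -> inrange m c.2.2.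
Proof. by rewrite astepE; case: ifP => // /andP[]. Qed.

Lemma piter_nz c n c' : (forall k d, (k < n)%N -> piter ast k c = Some d -> d.2.1 != 0) ->
  piter ast n c = Some c' -> piter (nzstep M y m) n (c.1, c.2.2) = Some (c'.1, c'.2.2).
Proof.
elim: n c => [|n IH] c nz /=; first by case=> ->.
case e: (ast c) => [d|//] /= h.
have -> : nzstep M y m (c.1, c.2.2) = Some (d.1, d.2.2).
  have c0 := nz 0%N c isT erefl; move: e; rewrite astepE /nzstep /=.
  case: ifP => // /andP[-> _]; rewrite /step /sigd c0.
  by case: mdelta => // q /=; case: ifP => // _ [<-].
by apply: IH h => k d' lt dk; apply: (nz k.+1) => //=; rewrite e.
Qed.

Lemma ast_ctr n c c' : piter ast n c = Some c' -> c.2.1 - n%:Z <= c'.2.1 <= c.2.1 + n%:Z.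
Proof.
move=> h; apply: (@piter_ctr _ M y m); move: h.
elim: n c => //= n IH c; case e: (ast c) => [d|//] /= /IH.
by move: e; rewrite astepE; case: ifP => // _ ->.
Qed.

Lemma nzstep_inrange c c' : nzstep M y m c = Some c' -> inrange m c.2.
Proof. by rewrite /nzstep; case: ifP. Qed.

(** A path with more steps than there are vertices repeats one and closes a cycle. *)
Lemma nz_bounded n c d : piter (nzstep M y m) n c = Some d -> (n <= N)%N.
Proof.
move=> h; rewrite leqNgt; apply/negP => lt.
pose f k : mst M * 'I_m.+1 :=
  if piter (nzstep M y m) k c is Some e then (e.1, inord `|e.2|%N) else (c.1, ord0).
have [|i [j [/andP[lij ljn] fij]]] := @pigeonhole _ f N.
  by rewrite card_prod card_ord.
have P l : (l <= N)%N -> exists2 e, piter (nzstep M y m) l c = Some e & inrange m e.2.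
  move=> ll; have [e + _] := piter_prefix (leq_ltn_trans ll lt) h.
  rewrite piterSr; case: (piter _ l c) => [e'|//] /= /nzstep_inrange.
  by exists e'.
have [ei hi ri] := P _ (leq_trans (ltnW lij) ljn); have [ej hj rj] := P _ ljn.
have [e' hi' hij] := piter_prefix (ltnW lij) hj.
have {hi'} e'E : e' = ei by move: hi'; rewrite hi => -[->].
have eE : ei = ej.
  move: fij; rewrite /f hi hj => -[e1 /(congr1 val)].
  rewrite /= !inordK; [|by move: ri rj; rewrite /inrange; lia..].
  case: ei ej e1 ri rj {hi hj hij e'E} => [q1 b1] [q2 b2] /= ->.
  by rewrite /inrange => ri rj e2; congr (_, _); lia.
apply: (acyclic (c := ei)); exists (j - i).-1.
by rewrite prednK ?subn_gt0 // {2}eE -e'E.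
Qed.

(** Otherwise the chain needs more than [N] steps to bring the counter down, and its first [N.+1]
    steps see a nonzero counter: too long a path of the nonzero graph. *)
Lemma ancestor_ctr n c c' : piter ast n c = Some c' -> (`|c.2.1| <= N + `|c'.2.1|)%N.
Proof.
move=> h; rewrite leqNgt; apply/negP => lt.
have ltn : (N < n)%N by have := ast_ctr h; lia.
have [d dN _] := piter_prefix ltn h.
have /nz_bounded : piter (nzstep M y m) N.+1 (c.1, c.2.2) = Some (d.1, d.2.2).
  by apply: piter_nz dN => k e lk /ast_ctr; lia.
by rewrite ltnn.
Qed.

(** All ancestors of [c] lie in a finite box. A longer chain would repeat a configuration, which
    would then reach the terminal [h] after two different numbers of steps. *)
Lemma ancestors_bounded K c h : piter ast K c = Some h -> ast h = None ->
  exists n, forall k e, piter ast k e = Some c -> (k <= n)%N.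
Proof.
move=> hK hN; pose W := (N + `|c.2.1|)%N.
exists #|{: mst M * 'I_(W.*2).+1 * 'I_m.+1}|.+1 => k e ek; rewrite leqNgt; apply/negP => lt.
pose f i : mst M * 'I_(W.*2).+1 * 'I_m.+1 :=
  if piter ast i e is Some d then (d.1, inord `|(d.2.1 + W%:Z)%R|%N, inord `|d.2.2|%N)
  else (c.1, ord0, ord0).
have [i [j [/andP[lij ljn] fij]]] := @pigeonhole _ f _ (leqnn _).
have P d l : (l <= #|{: mst M * 'I_(W.*2).+1 * 'I_m.+1}|)%N -> piter ast l e = Some d ->
    inrange m d.2.2 /\ (`|d.2.1| <= W)%N.
  move=> ll hl; have [d' hl' hk'] := piter_prefix (leq_trans ll (ltnW (ltnW lt))) ek.
  move: hl'; rewrite hl => -[e']; subst d'; split; last exact: ancestor_ctr hk'.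
  have lk : (l.+1 <= k)%N by apply: leq_trans (ltnW lt); rewrite ltnS.
  have [d' + _] := piter_prefix lk ek.
  by rewrite piterSr hl /=; exact: ast_inrange.
have ljk := leq_trans ljn (ltnW (ltnW lt)).
have [ci hi hik] := piter_prefix (leq_trans (ltnW lij) ljk) ek.
have [cj hj hjk] := piter_prefix ljk ek.
have [ri ai] := P _ _ (leq_trans (ltnW lij) ljn) hi.
have [rj aj] := P _ _ ljn hj.
move: fij; rewrite /f hi hj => -[e1 /(congr1 val) e2 /(congr1 val) e3].
move: e2 e3; rewrite /= !inordK; [|by move: ri rj; rewrite /inrange; lia..|by lia|by lia].
move=> e2 e3; have eij : ci = cj.
  case: ci cj {hi hik hj hjk} e1 e2 e3 ri rj ai aj => [q1 [a1 b1]] [q2 [a2 b2]] /= -> e2 e3.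
  by rewrite /inrange => ri rj ai aj; congr (_, (_, _)); lia.
subst cj; have hiK : piter ast (k - i + K) ci = Some h by rewrite piterD hik.
have hjK : piter ast (k - j + K) ci = Some h by rewrite piterD hjk.
by have [] := piter_stop_uniq hN hN hiK hjK; lia.
Qed.

(** A step of [M] is simulated by touring the remaining siblings of the current configuration. These
    tours are finite because ancestor chains of the next configuration are bounded. *)
Lemma tour_reach h : mmov (mini M) = tri0 ->
  reach (step M y m) (minit M) h -> macc h.1 || mrej h.1 ->
  reach (step tour y m) (minit tour) (inl h.1, h.2).
Proof.
move=> mv0 rh hh; have arr := arrival mv0.
have haN : ast h = None by rewrite astepE step_halt // if_same.
have E c : reach (step M y m) (minit M) c -> reach (step M y m) c h ->
    reach est (inl c.1, c.2) (inl h.1, h.2).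
  move=> + [n]; elim: n c => [|n IH] c rc /=; first by case=> ->; exact: reach_refl.
  case st: (step M y m c) => [d|//] /= hn.
  have rd := reach_trans rc (reach_step st).
  apply: reach_trans (IH d rd hn).
  have [r1 r2] := arr _ rc.
  have sa : ast c = Some d by rewrite astepE r1 r2.
  have [K dK] : reach ast d h.
    exists n; elim: n d rd hn {IH st sa} => [|n IH] d rd //=.
    case st: (step M y m d) => [d'|//] /= hn; have [r3 r4] := arr _ rd.
    by rewrite astepE r3 r4 st /=; apply: IH hn => //; apply: reach_trans rd (reach_step st).
  have [B Bd] := ancestors_bounded dK haN.
  move: sa; case: c {rc hn st r1 r2} => q p; rewrite /astep /=; case pq: (tphi p q) => [q'|//] [dE].
  subst d; have qc : q \in children (tphi p) q' by rewrite mem_children pq.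
  have dich r : r \in children (tphi p) q' ->
      stopped tphi (@shift A M) (@unshift A M) xpred0 r p \/
      toured tphi (@shift A M) (@unshift A M) xpred0 r p.
    rewrite mem_children => /eqP pr; apply: (@tour_subtree _ _ _ _ _ _ _ _ B) => [s|s|k e ek].
    - exact: shiftK.
    - exact: unshiftK.
    by apply: ltnW; apply: (Bd k.+1 e); rewrite piterSr ek /= /astep /= pr.
  have /onthP [i qi] := qc.
  have [[r' [p' []]]//|[rs _]] := tour_siblings dich qi.
  by apply: eq_reach rs => -[[u|u] v].
apply: est_reach; last exact: (E _ (reach_refl _ _) rh).
by rewrite /good /inrange /=; lia.
Qed.

(** The nonzero graph of [tour] is an Euler tour of that of [M], with cells as places. A recurrent
    [inr r] leads to [inl r], and a recurrent [inl q] would yield arbitrarily long paths of [M]. *)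
Lemma tour_acyclic c : ~ recurrent (nzstep tour y m) c.
Proof.
pose psi (b : int) : mst M -> option (mst M) :=
  if inrange m b then gdelta (y b) true else fun _ => None.
pose mv (q : mst M) (b : int) := b + mu (mmov q).
pose mvi (q : mst M) (b : int) := b - mu (mmov q).
have mvK q : cancel (mv q) (mvi q) by move=> b; rewrite /mvi /mv addrK.
have mviK q : cancel (mvi q) (mv q) by move=> b; rewrite /mvi /mv subrK.
have nzE d e : nzstep tour y m d = Some e -> estep psi mv mvi d = Some e.
  rewrite /nzstep /estep /psi; case: ifP => // _; rewrite /= /tour_delta.
  case: (eul _ d.1) => [d'|//]; case: ifP => // _ [<-] /=.
  by case: d' => q; rewrite /mv /mvi /= ?mu_tneg.
have asE d e : astep psi mv d = Some e -> nzstep M y m d = Some e.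
  rewrite /astep /nzstep /psi; case: ifP => //= r; rewrite /gdelta.
  case: mdelta => [q|//]; rewrite okout_inrange //; case: ifP => // /andP[_ ->] /= [<-].
  by [].
have asn n d e : piter (astep psi mv) n d = Some e -> piter (nzstep M y m) n d = Some e.
  elim: n d => //= n IH d; case h: (astep _ _ d) => [d'|//] /= /IH.
  by rewrite (asE _ _ h).
have tourK r b : toured psi mv mvi xpred0 r b.
  have [|[r' [b' []]]//|//] := @tour_subtree _ _ psi mv mvi mvK mviK xpred0 N r b.
  by move=> k e /asn /nz_bounded.
have s0 d : sstep psi mv mvi xpred0 d = estep psi mv mvi d by case: d => [[]].
have rec_est d : recurrent (nzstep tour y m) d -> recurrent (estep psi mv mvi) d.
  move=> [n h]; exists n; move: h; move: {1 3}d => e; elim: n.+1 e => //= k IH e.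
  by case h: nzstep => [e'|//] /= /IH; rewrite (nzE _ _ h).
(* Later siblings have finite subtrees, so the tour proceeds from [q] to its parent, which is then
   recurrent as well. *)
have up q b : recurrent (estep psi mv mvi) (inl q, b) ->
    exists2 d, astep psi mv (q, b) = Some d & recurrent (estep psi mv mvi) (inl d.1, d.2).
  move=> rc; have [e + _] := (recurrentP _ _).1 rc.
  rewrite /estep /eul /=; case pq: (psi b q) => [q'|//] _.
  exists (q', mv q' b); first by rewrite /astep /= pq.
  have qc : q \in children (psi b) q' by rewrite mem_children pq.
  have /onthP [i qi] := qc.
  have [|[r' [p' []]]//|[rs _]] := @tour_siblings _ _ psi mv mvi xpred0 q' b i q _ qi.
    by move=> r _; right; exact: tourK.
  by apply: recurrent_reach rc (eq_reach s0 rs).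
have noF q b : ~ recurrent (estep psi mv mvi) (inl q, b).
  move=> rc; have [d dN] : exists d, piter (astep psi mv) N.+1 (q, b) = Some d.
    elim: N.+1 q b rc => [|n IH] q b rc; first by exists (q, b).
    have [[q' b'] e1 e2] := up _ _ rc; have [d hd] := IH _ _ e2.
    by exists d; rewrite /= e1.
  by have := nz_bounded (asn _ _ _ dN); rewrite ltnn.
move=> /rec_est; case: c => [[q|r] b] rc; first exact: noF rc.
apply: (noF r (mv r b)); apply: recurrent_reach rc _.
have [+ _] := tourK r (mv r b); rewrite mvK; exact: eq_reach.
Qed.

End TourRun.
End Reversal.

Section Guard.
Context {A : Type} (M : machine A) (lft rgt : A -> bool).

Definition guard : machine A := @Machine A (mst M) (gdelta lft rgt) (@mctr _ M) (@mmov _ M)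
  (mini M) (@macc _ M) (@mrej _ M) (mini_live M) (@macc_rej _ M)
  (fun a s q h => ltac:(by rewrite /gdelta mhalt)).

Lemma guard_guarded : guarded guard lft rgt.
Proof.
move=> a s q q' /=; rewrite {1}/gdelta; case: mdelta => // u; case: ifP => // h [<-].
exact: h.
Qed.

(** A run from the initial configuration never uses the transitions removed by [guard]. *)
Lemma guard_solves X (m : X -> nat) (T : X -> int -> A) L :
  (forall x b, inrange (m x) b -> lft (T x b) = (b == 0)) ->
  (forall x b, inrange (m x) b -> rgt (T x b) = (b == (m x)%:Z)) ->
  mmov (mini M) = tri0 -> solves m M T L -> solves m guard T L.
Proof.
move=> lE rE mv0 sM x.
suff E c : reach (step M (T x) (m x)) (minit M) c ->
    reach (step guard (T x) (m x)) (minit guard) c.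
  by split=> [/(sM x).1|/(sM x).2] [c /E rc hc]; exists c.
move=> [n]; elim: n c => [|n IH] c; first by case=> <-; exact: reach_refl.
rewrite piterSr; case e: (piter _ n _) => [d|//] /= st.
apply: reach_trans (IH _ e) (reach_step _).
have [r1 r2] := arrival mv0 (ex_intro _ n e).
move: st; rewrite /step /= /gdelta.
case: (mdelta (T x d.2.2) (sigd d.2) d.1) => // q; case: ifP => // rq.
rewrite (okin_inrange (lE x) (rE x)) // (okout_inrange (lE x) (rE x)) // r2.
by rewrite /= in rq; rewrite rq /= rq.
Qed.

End Guard.

Section Determinism.
Context {X : Type} (m : X -> nat).

Definition right_marked {A : Type} (T : X -> int -> A) : Prop :=
  exists rgt : A -> bool, forall x b, inrange (m x) b -> rgt (T x b) = (b == (m x)%:Z).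

Lemma solvable_acyclic A (M : machine A) (T : X -> int -> A) L :
  left_marked m T -> right_marked T -> mmov (mini M) = tri0 ->
  (forall x c, ~ recurrent (nzstep M (T x) (m x)) c) ->
  solves m M T L -> solvable m T L.
Proof.
move=> [lft lE] [rgt rE] mv0 ac sM; exists (tour M lft rgt); split.
  exact: tour_reversible.
move=> x; split=> [/(sM x).1|/(sM x).2] [c rc hc]; exists (inl c.1, c.2) => //;
  by apply: (tour_reach (lE x) (rE x) (ac x)) => //; rewrite hc ?orbT.
Qed.

End Determinism.

(** * From the circular to the linear tape *)

Section Linear.
Variables (Sigma Q : finType) (M : D1CA Sigma Q).

(** [tIni] occurs at the start only: [d_q0] may belong to a halting set, while halting counts only
    upon entering a state. *)
Definition lintag : finType := (bool * bool)%type.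
Definition linst : finType := (lintag * Q * tri * tri)%type.
Local Notation tIni := (false, false).
Local Notation tNorm := (false, true).
Local Notation tWL := (true, false).
Local Notation tWR := (true, true).

(* A state records its last move.  Instead of crossing the junction of the circular tape,
   the head walks to the other end (tWL, tWR). *)
Definition lin_delta (g : Gamma Sigma) (s : bool) (st : linst) : option linst :=
  let: (t, q, _, _) := st in
  match t with
  | tWL => if g == dollar then Some (tNorm, q, tri0, tri0) else Some (tWL, q, tri0, triR)
  | tWR => if g == cent then Some (tNorm, q, tri0, tri0) else Some (tWR, q, tri0, triL)
  | _ =>
      if (t == tNorm) && ((q \in d_acc M) || (q \in d_rej M)) then None
      else let: (q', c, d) := d_delta M q g s in
      if (g == cent) && (d == triL) then Some (tWL, q', c, triR)
      else if (g == dollar) && (d == triR) then Some (tWR, q', c, triL)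
      else Some (tNorm, q', c, d)
  end.

Definition lin_acc (st : linst) : bool := (st.1.1.1 == tNorm) && (st.1.1.2 \in d_acc M).
Definition lin_rej (st : linst) : bool := (st.1.1.1 == tNorm) && (st.1.1.2 \in d_rej M).

Fact lin_live : ~~ (lin_acc (tIni, d_q0 M, tri0, tri0) || lin_rej (tIni, d_q0 M, tri0, tri0)).
Proof. by []. Qed.

Fact lin_acc_rej st : ~~ (lin_acc st && lin_rej st).
Proof.
apply/negP => /andP[/andP[_ h1] /andP[_ h2]].
by have := disjointFr (d_disj M) h1; rewrite h2.
Qed.

Fact lin_halt g s st : lin_acc st || lin_rej st -> lin_delta g s st = None.
Proof.
case: st => [[[t q] c] d]; rewrite /lin_acc /lin_rej /= -andb_orr => /andP[/eqP -> h].
by rewrite h.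
Qed.

Definition linear : machine (Gamma Sigma) :=
  @Machine _ linst lin_delta (fun st => st.1.2) (fun st => st.2) _ _ _
    lin_live lin_acc_rej lin_halt.

Section LinearRun.
Variable x : seq Sigma.
Let y (b : int) : Gamma Sigma := tape x `|b|%N.
Let m := (size x).+1.

Lemma tape_cent (b : nat) : (tape x b == cent) = (b == 0)%N.
Proof. by case: b => [|b] //; rewrite /tape /=; case: onth. Qed.

Lemma tape_dollar (b : nat) : (b <= m)%N -> (tape x b == dollar) = (b == m).
Proof.
case: b => [|b] //; rewrite /tape /= ltnS eqSS => le.
have := onthTE x b; case: (onth x b) => [s|] /= h.
  by have -> : (inl s == dollar :> Gamma Sigma) = false by []; lia.
by rewrite eqxx; lia.
Qed.

Local Notation lreach := (reach (step linear y m)).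

Lemma walk_right q c d a (b : nat) : (b <= m)%N ->
  lreach ((tWL, q, c, d) : mst linear, (a, b%:Z)) ((tNorm, q, tri0, tri0) : mst linear, (a, m%:Z)).
Proof.
elim: {b}(m - b)%N {-2}b (erefl (m - b)%N) c d => [|n IH] b e c d le.
  have -> : b = m by lia.
  apply: reach_move (reach_refl _ _); rewrite /= ?mu_tri0 ?addr0 //; last by rewrite /inrange; lia.
  by rewrite /y /= tape_dollar // eqxx.
apply: reach_move (IH b.+1 _ tri0 triR _); rewrite /= ?mu_tri0 ?mu_triR;
  [|lia|lia|rewrite /inrange; lia|lia|lia].
by rewrite /y /= tape_dollar //; have -> : (b == m) = false by lia.
Qed.

Lemma walk_left q c d a (b : nat) : (b <= m)%N ->
  lreach ((tWR, q, c, d) : mst linear, (a, b%:Z)) ((tNorm, q, tri0, tri0) : mst linear, (a, 0)).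
Proof.
elim: b c d => [|b IH] c d le.
  by apply: reach_move (reach_refl _ _); rewrite /= ?mu_tri0 ?addr0 /inrange //.
apply: reach_move (IH tri0 triL _); rewrite /= ?mu_tri0 ?mu_triL;
  [|lia|lia|rewrite /inrange; lia|lia].
by rewrite /y /= tape_cent.
Qed.

Lemma lin_sim t q c d a (b : pos x) :
  t = tIni \/ t = tNorm /\ ~~ ((q \in d_acc M) || (q \in d_rej M)) ->
  exists c' d', lreach ((t, q, c, d) : mst linear, (a, (nat_of_ord b)%:Z))
    ((tNorm, (dstep M (q, a, b)).1.1, c', d') : mst linear,
     ((dstep M (q, a, b)).1.2, (nat_of_ord (dstep M (q, a, b)).2)%:Z)).
Proof.
move=> ht; rewrite /dstep; case e: (d_delta M q (tape x b) (sgn a)) => [[q' c'] d'] /=.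
have lb : (b <= m)%N by have := ltn_ord b; rewrite /m; lia.
have D : lin_delta (y (nat_of_ord b)%:Z) (a != 0) (t, q, c, d) =
    if ((nat_of_ord b) == 0)%N && (d' == triL) then Some (tWL, q', c', triR)
    else if ((nat_of_ord b) == m) && (d' == triR) then Some (tWR, q', c', triL)
    else Some (tNorm, q', c', d').
  rewrite /lin_delta /y /= -[a != 0]/(sgn a) e tape_cent tape_dollar //.
  by case: ht => [->|[-> /negbTE ->]].
have [wl|nwl] := boolP (((nat_of_ord b) == 0)%N && (d' == triL)).
  exists tri0, tri0; rewrite wl in D.
  have -> : nat_of_ord (hshift b (mu d')) = m.
    move: wl => /andP[/eqP b0 /eqP ->]; rewrite /hshift mu_triL b0 add0r.
    rewrite -[(-1 %% _)%Z](modzDr) modz_small /m; last by lia.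
    by rewrite inordK; lia.
  move: wl => /andP[/eqP b0 _]; rewrite b0 in D *.
  (* The transition itself makes the first step of the walk, to cell 1. *)
  apply: (@reach_move _ linear _ _ _ _ _ _ (a + mu c') 1%:Z _ D) => //.
  exact: walk_right.
have [wr|nwr] := boolP (((nat_of_ord b) == m) && (d' == triR)).
  exists tri0, tri0; rewrite (negbTE nwl) wr in D.
  move: wr => /andP[/eqP bm /eqP dR].
  have -> : nat_of_ord (hshift b (mu d')) = 0%N.
    rewrite /hshift dR mu_triR bm; have -> : m%:Z + 1 = (size x).+2%:Z by rewrite /m; lia.
    by rewrite modzz inordK.
  rewrite bm in D *.
  apply: (@reach_move _ linear _ _ _ _ _ _ (a + mu c') (size x)%:Z _ D) => //.
  - by rewrite /= mu_triL /m; lia.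
  - by rewrite /inrange /m; lia.
  by apply: walk_left; rewrite /m.
exists c', d'; rewrite (negbTE nwl) (negbTE nwr) in D.
have r : inrange m ((nat_of_ord b)%:Z + mu d').
  move: nwl nwr lb; rewrite /inrange /m.
  have [->|->|->] := triP d'; rewrite ?mu_triL ?mu_triR ?mu_tri0 ?tri_eqE ?eqxx /=; lia.
have -> : (nat_of_ord (hshift b (mu d')))%:Z = (nat_of_ord b)%:Z + mu d'.
  rewrite /hshift; move: r; rewrite /inrange /m => r.
  rewrite modz_small ?inordK; lia.
by apply: (@reach_move _ linear _ _ _ _ _ _ _ _ _ D) => //; exact: reach_refl.
Qed.

Lemma lin_run k : (forall j, (0 < j < k)%N -> dstate M x j \notin (d_acc M :|: d_rej M)) ->
  exists t c d, t = (if k == 0%N then tIni else tNorm) /\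
    lreach (minit linear) ((t, (drun M x k).1.1, c, d) : mst linear,
      ((drun M x k).1.2, (nat_of_ord (drun M x k).2)%:Z)).
Proof.
elim: k => [|k IH] nh.
  by exists tIni, tri0, tri0; split=> //; exact: reach_refl.
have [|t [c [d [tE r]]]] := IH; first by move=> j hj; apply: nh; lia.
have ht : t = tIni \/ t = tNorm /\
    ~~ (((drun M x k).1.1 \in d_acc M) || ((drun M x k).1.1 \in d_rej M)).
  move: tE; case: eqP => [|k0] -> ; [by left|right; split=> //].
  by have := nh k; rewrite /dstate finset.in_setU => -> //; lia.
have := lin_sim c d (drun M x k).1.2 (drun M x k).2 ht.
rewrite -!surjective_pairing => -[c' [d' r']].
exists tNorm, c', d'; split=> //; exact: reach_trans r r'.
Qed.

End LinearRun.

Lemma linear_solves L : d_recognizes M L ->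
  solves (fun x : seq Sigma => (size x).+1) linear (fun x b => tape x `|b|%N) L.
Proof.
move=> rec x; split=> [/(rec x).1|/(rec x).2] [k [k0 [hk nh]]];
  have [t [c [d [tE r]]]] := lin_run nh;
  (have {}tE : t = tNorm by rewrite tE; case: (k) k0);
  exists ((t, (drun M x k).1.1, c, d) : mst linear,
    ((drun M x k).1.2, (nat_of_ord (drun M x k).2)%:Z)) => //;
  by rewrite tE /= /lin_acc /lin_rej /=.
Qed.

Lemma tape_left_marked :
  left_marked (fun x : seq Sigma => (size x).+1) (fun x b => tape x `|b|%N).
Proof.
exists (fun g => g == cent) => x b; rewrite /inrange tape_cent; lia.
Qed.

Lemma tape_right_marked :
  right_marked (fun x : seq Sigma => (size x).+1) (fun x b => tape x `|b|%N).
Proof.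
exists (fun g => g == dollar) => x b; rewrite /inrange => r; rewrite tape_dollar; lia.
Qed.

End Linear.

(** * Cut vertices *)

Section Cuts.
Context {A : Type} (M : machine A).
Local Notation St := (mst M).

(* The next visit to the current cell, given the return map P of the cells on its left,
   or (with true) the exit to the right. *)
Definition return_step (a : A) (P : St -> option St) (r : St) : option (bool * St) :=
  if mdelta a true r is Some u then
    if mmov u == tri0 then Some (false, u)
    else if mmov u == triR then Some (true, u)
    else omap (pair false) (P u)
  else None.

Inductive exits (a : A) (P : St -> option St) (r r' : St) : Prop :=
| exits_now of return_step a P r = Some (true, r')
| exits_later r1 of return_step a P r = Some (false, r1) & exits a P r1 r'.

Lemma exits_fun a P r r1 r2 : exits a P r r1 -> exits a P r r2 -> r1 = r2.
Proof.
move=> e1; elim: e1 r2 => {r r1} [r r1 h|r r1 s h _ IH] r2 [h2|t h2 e2];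
  move: h2; rewrite h // => -[] //.
by move=> st; apply: IH; rewrite st.
Qed.

(** Shepherdson's table of a two-way automaton, for nonzero counter: it sends a state on the left
    neighbour of a cell to the state in which that cell is next reached. There are finitely many
    tables, so a finite automaton computes them. *)
Definition profile_next (a : A) (P : {ffun St -> option St}) : {ffun St -> option St} :=
  [ffun r => if pselect (exists r', exits a P r r') is left h then Some (projT1 (cid h)) else None].

Lemma profile_nextP a P r r' : profile_next a P r = Some r' <-> exits a P r r'.
Proof.
rewrite ffunE; case: pselect => [h|h]; last by split=> // e; case: h; exists r'.
case: (cid h) => s es /=; split=> [[<-]//|e]; by rewrite (exits_fun es e).
Qed.

Definition stay_step (a : A) (P : St -> option St) (r : St) : option St :=
  if return_step a P r is Some (false, r1) then Some r1 else None.

(* One state is chosen on every cycle that has the current cell as its rightmost one. *)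
Definition cut (a : A) (P : St -> option St) (q : St) : bool :=
  `[< (exists n, piter (stay_step a P) n.+1 q = Some q) /\
      forall j r, piter (stay_step a P) j q = Some r -> (enum_rank q <= enum_rank r)%N >].

Lemma cut_live a P q : cut a P q -> mdelta a true q <> None.
Proof.
by move=> /asboolP [[n] + _] e; rewrite /= /stay_step /return_step e.
Qed.

Section CutRun.
Variables (y : int -> A) (m : nat).

Local Notation F := (nzstep M y m).

Definition profile (b : int) : {ffun St -> option St} := label profile_next [ffun=> None] y b.

Definition is_cut (c : St * int) : bool := inrange m c.2 && cut (y c.2) (profile c.2) c.1.

(** Only the source of a step is kept left of [b]; the target may be [b], so that a path ends upon
    first reaching [b]. *)
Definition left_of (b : nat) (c : St * int) : option (St * int) :=
  if c.2 < b%:Z then F c else None.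

Lemma left_ofE b c d : left_of b c = Some d -> c.2 < b%:Z /\ F c = Some d.
Proof. by rewrite /left_of; case: ifP. Qed.

Lemma left_of_sub b n c d : piter (left_of b) n c = Some d -> piter F n c = Some d.
Proof.
elim: n c => //= n IH c; case e: (left_of b c) => [c'|] //= /IH.
by have [_ ->] := left_ofE e.
Qed.

Lemma left_of_mono b n c d : piter (left_of b) n c = Some d -> piter (left_of b.+1) n c = Some d.
Proof.
have one e e' : left_of b e = Some e' -> left_of b.+1 e = Some e'.
  by rewrite /left_of; case: ifP => // lt; rewrite ifT //; lia.
elim: n c => //= n IH c; case e: (left_of b c) => [c'|] //= /IH.
by rewrite (one _ _ e).
Qed.

Lemma FE q b r : F (q, b) = Some r -> [/\ inrange m b, inrange m r.2 &
  mdelta (y b) true q = Some r.1 /\ r.2 = b + mu (mmov r.1)].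
Proof.
rewrite /nzstep /=; case: ifP => // rb; case: mdelta => // u; case: ifP => // ru [<-].
by split.
Qed.

Lemma return_step_sound b r r1 :
  (forall u s, profile b%:Z u = Some s -> (0 < b)%N /\ reach (left_of b) (u, b%:Z - 1) (s, b%:Z)) ->
  (b <= m)%N -> return_step (y b%:Z) (profile b%:Z) r = Some (false, r1) ->
  exists2 d, left_of b.+1 (r, b%:Z) = Some d & reach (left_of b.+1) d (r1, b%:Z).
Proof.
move=> H le; have rb : inrange m b%:Z by rewrite /inrange; lia.
have ltb : b%:Z < b.+1%:Z by lia.
rewrite /return_step; case e: mdelta => [u|//]; rewrite /left_of /nzstep /= ltb rb e.
case: eqP => [u0 [<-]|u0].
  by exists (u, b%:Z); [rewrite u0 mu_tri0 addr0 rb|exact: reach_refl].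
case: eqP => // uR; case ps: (profile b u) => [s|//] [<-].
have uL : mmov u = triL by have [] := triP (mmov u).
have [b0 [n hn]] := H _ _ ps.
have rb1 : inrange m (b%:Z - 1) by rewrite /inrange; lia.
exists (u, b%:Z - 1); first by rewrite uL mu_triL rb1.
by exists n; apply: left_of_mono.
Qed.

Lemma profile_sound b u s : (b <= m)%N -> profile b%:Z u = Some s ->
  (0 < b)%N /\ reach (left_of b) (u, b%:Z - 1) (s, b%:Z).
Proof.
elim: b u s => [|b IH] u s le; first by rewrite /profile /label /= ffunE.
rewrite /profile label_next -/(profile b%:Z) => /profile_nextP e; split=> //.
have -> : b.+1%:Z - 1 = b%:Z by lia.
elim: e => {u s} [u s|u s r h _ IHe].
  rewrite /return_step; case e: mdelta => [v|//]; case: eqP => // _.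
  case: eqP => [vR|_]; last by case: (profile b%:Z v).
  have ltb : b%:Z < b.+1%:Z by lia.
  have rb : inrange m b%:Z by rewrite /inrange; lia.
  have rb1 : inrange m (b%:Z + 1) by rewrite /inrange; lia.
  move=> [<-]; apply: reach_step; rewrite /left_of /nzstep /= ltb rb e vR mu_triR rb1.
  by congr (Some (_, _)); lia.
have [d e1 e2] := return_step_sound (fun u' s' => IH u' s' (ltnW le)) (ltnW le) h.
by apply: reach_next e1 (reach_trans e2 IHe).
Qed.

Lemma stay_sound b q r : (b <= m)%N -> stay_step (y b%:Z) (profile b%:Z) q = Some r ->
  exists2 d, left_of b.+1 (q, b%:Z) = Some d & reach (left_of b.+1) d (r, b%:Z).
Proof.
move=> le; rewrite /stay_step; case e: return_step => [[[] s]|] // [<-].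
by apply: return_step_sound e => // u t; apply: profile_sound.
Qed.

(** The head moves by at most one cell, so the path cannot pass [b] unseen; it is split at the first
    visit. *)
Lemma path_split b n c (k e : int) u r : (k < b%:Z) -> b%:Z <= e ->
  piter (left_of c) n (u, k) = Some (r, e) ->
  exists n1 s, [/\ (n1 <= n)%N, piter (left_of b) n1 (u, k) = Some (s, b%:Z) &
     piter (left_of c) (n - n1) (s, b%:Z) = Some (r, e)].
Proof.
elim: n u k => [|n IH] u k lk le /=; first by case=> _ ke; lia.
case lo: (left_of c (u, k)) => [[v l]|//] /= h; have [kc f] := left_ofE lo.
have lo' : left_of b (u, k) = Some (v, l) by rewrite /left_of lk.
have [_ _ /= [_ lE]] := FE f; have := mu_bound (mmov v) => bd.
have [lb|lb] := ltP l b%:Z.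
  have [n1 [s [h1 h2 h3]]] := IH v l lb le h; exists n1.+1, s.
  by rewrite /= lo' /= subSS.
have lE' : l = b%:Z by lia.
exists 1%N, v; rewrite /= lo' /= subn1 /= lE'; split=> //.
by rewrite -lE'.
Qed.

Lemma return_step_complete b n r (e : int) s : (b <= m)%N -> b%:Z <= e ->
  (forall u t, (0 < b)%N -> reach (left_of b) (u, b%:Z - 1) (t, b%:Z) -> profile b%:Z u = Some t) ->
  piter (left_of b.+1) n.+1 (r, b%:Z) = Some (s, e) ->
  (return_step (y b%:Z) (profile b%:Z) r = Some (true, s) /\ e = b.+1%:Z) \/
  exists n1 r1, [/\ (n1 <= n)%N, return_step (y b%:Z) (profile b%:Z) r = Some (false, r1) &
    piter (left_of b.+1) n1 (r1, b%:Z) = Some (s, e)].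
Proof.
move=> le lbe H /=; case lo: (left_of b.+1 (r, b%:Z)) => [[u l]|//] /= h.
have [_ f] := left_ofE lo.
have [_ rl /= [dl lE]] := FE f; rewrite /return_step dl.
have [uL|u0|uR] := triP (mmov u).
- rewrite uL ?tri_eqE ?eqxx; move: lE; rewrite uL mu_triL => lE.
  have b0 : (0 < b)%N by move: rl; rewrite /inrange /=; lia.
  have lb : l < b%:Z by lia.
  have [n1 [t [h1 h2 h3]]] := path_split lb lbe h.
  have -> : profile b%:Z u = Some t.
    by apply: H => //; exists n1; rewrite -h2 lE.
  by right; exists (n - n1)%N, t; split=> //; lia.
- right; exists n, u; rewrite u0 eqxx; split=> //.
  by rewrite -h lE u0 mu_tri0 addr0.
- left; rewrite uR tri_eqE eqxx; move: lE; rewrite uR mu_triR => lE.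
  case: n h => [|n] /=; first by case=> <- <-; split=> //; lia.
  case lo': (left_of b.+1 (u, l)) => [d|//]; have [] := left_ofE lo' => /=; lia.
Qed.

Lemma profile_complete b u t : (b <= m)%N -> (0 < b)%N ->
  reach (left_of b) (u, b%:Z - 1) (t, b%:Z) -> profile b%:Z u = Some t.
Proof.
elim: b u t => [//|b IH] u t le _; have -> : b.+1%:Z - 1 = b%:Z by lia.
move=> [n]; rewrite /profile label_next -/(profile b%:Z) => h; apply/profile_nextP.
elim/ltn_ind: n u h => n IHn u; case: n IHn => [|n] IHn; first by case=> _; lia.
move=> h; have lb : b%:Z <= b.+1%:Z by lia.
have H u' t' (b0 : (0 < b)%N) := IH u' t' (ltnW le) b0.
have [[e _]|[n1 [r1 [le1 e1 e2]]]] := return_step_complete (ltnW le) lb H h.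
  exact: exits_now.
exact: exits_later e1 (IHn _ _ _ e2).
Qed.

Lemma stay_complete b n q r : (b <= m)%N -> piter (left_of b.+1) n (q, b%:Z) = Some (r, b%:Z) ->
  exists j, piter (stay_step (y b%:Z) (profile b%:Z)) j q = Some r /\ ((0 < n)%N -> (0 < j)%N).
Proof.
move=> le; elim/ltn_ind: n q => n IHn q; case: n IHn => [|n] IHn.
  by case=> ->; exists 0%N.
move=> h; have H u t (b0 : (0 < b)%N) := @profile_complete b u t le b0.
have [[_ e]|[n1 [r1 [le1 e1 e2]]]] := return_step_complete le (lexx _) H h; first by lia.
have [//|j [hj _]] := IHn n1 _ r1 e2.
by exists j.+1; rewrite /= /stay_step e1.
Qed.

Lemma stay_reach b n q r : (b <= m)%N ->
  piter (stay_step (y b%:Z) (profile b%:Z)) n q = Some r ->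
  reach (left_of b.+1) (q, b%:Z) (r, b%:Z).
Proof.
move=> le; elim: n q => [|n IH] q /=; first by case=> ->; exact: reach_refl.
case e: stay_step => [s|//] /= /IH h; have [d e1 e2] := stay_sound le e.
exact: reach_next e1 (reach_trans e2 h).
Qed.

Lemma left_of_reach b c d : reach (left_of b) c d -> reach F c d.
Proof. by move=> [n /left_of_sub h]; exists n. Qed.

Lemma is_cutP c : is_cut c -> exists q (b : nat), [/\ c = (q, b%:Z), (b <= m)%N,
  recurrent (left_of b.+1) c & forall j r,
  piter (stay_step (y b%:Z) (profile b%:Z)) j q = Some r -> (enum_rank q <= enum_rank r)%N].
Proof.
case: c => q b /andP[/= rb /asboolP [[n h] mn]].
have [k kE] : exists k : nat, b = k%:Z by exists `|b|%N; move: rb; rewrite /inrange; lia.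
subst b; exists q, k; have le : (k <= m)%N by move: rb; rewrite /inrange; lia.
split=> //; move: h => /=; case e: (stay_step _ _ q) => [s|//] /= /(stay_reach le) h.
have [d e1 e2] := stay_sound le e.
by apply/recurrentP; exists d => //; exact: reach_trans e2 h.
Qed.

Lemma recurrent_left_of b c d : recurrent (left_of b) c -> reach F c d -> d.2 < b%:Z.
Proof.
move=> + [n]; elim: n c => [|n IH] c rc /=.
  by case=> <-; have [e /left_ofE []] := (recurrentP _ _).1 rc.
have [e ce _] := (recurrentP _ _).1 rc; have [_ ->] /= := left_ofE ce.
by apply: IH; apply: recurrent_reach rc (reach_step ce).
Qed.

Definition uncut_step (c : St * int) : option (St * int) := if is_cut c then None else F c.

Lemma uncut_sub n c d : piter uncut_step n c = Some d -> piter F n c = Some d.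
Proof.
elim: n c => //= n IH c; case e: (uncut_step c) => [c'|] //= /IH.
by move: e; rewrite /uncut_step; case: ifP => // _ ->.
Qed.

(** The path stays on the cycle through [c]. Both cells are rightmost on this cycle, hence equal,
    and both states have least rank among those taken there. *)
Lemma cut_return n c d e : is_cut c -> F c = Some d -> piter uncut_step n d = Some e ->
  is_cut e -> e = c.
Proof.
move=> cc cd de ce; have [q [b [cE le rc mn]]] := is_cutP cc.
have [q' [b' [eE le' re mn']]] := is_cutP ce.
have [d' lcd [N dN]] := (recurrentP _ _).1 rc.
have [_ cd'] := left_ofE lcd; move: cd'; rewrite cd => -[dd]; subst d'.
(* A longer path would pass through [c], where [uncut_step] is undefined. *)
have leN : (n <= N)%N.
  rewrite leqNgt; apply/negP => lt; have [z dz ze] := piter_prefix (ltnW lt) de.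
  move: (uncut_sub dz); rewrite (left_of_sub dN) => -[cz]; subst z.
  have : (0 < n - N)%N by lia.
  by case: (n - N)%N ze => //= k; rewrite /uncut_step cc.
have [e' de' ec] := piter_prefix leN dN.
move: (left_of_sub de'); rewrite (uncut_sub de) => -[ee]; subst e'.
have rec_e : reach F e c by apply: left_of_reach; exists (N - n)%N; exact: ec.
have lb : (b' <= b)%N.
  have := recurrent_left_of rc (left_of_reach (reach_next lcd (ex_intro _ n de'))).
  by rewrite eE /=; lia.
have gb : (b <= b')%N.
  by have := recurrent_left_of re rec_e; rewrite cE /=; lia.
have bb : b' = b by lia.
subst b'; rewrite cE eE; congr (_, _); subst c e.
have h1 : piter (left_of b.+1) n.+1 (q, b%:Z) = Some (q', b%:Z) by rewrite /= lcd.
have [j [hj _]] := stay_complete le h1; have [j' [hj' _]] := stay_complete le ec.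
by apply: enum_rank_inj; apply/val_inj/eqP; rewrite eqn_leq (mn _ _ hj) (mn' _ _ hj').
Qed.

(** The cut vertex is found on the rightmost cell [b] of the cycle, as the state of least rank among
    those taken there. *)
Lemma cycle_has_cut c : recurrent F c -> exists2 e, reach F c e & is_cut e.
Proof.
move=> rc; have inr e : reach F c e -> inrange m e.2.
  move=> /(recurrent_reach rc) /recurrentP [[u l]]; case: e => q b /= h _.
  by have [] := FE h.
pose R k := `[< exists q, reach F c (q, k%:Z) >].
have exR : exists k, R k.
  exists `|c.2|%N; apply/asboolP; exists c.1; have := inr _ (reach_refl _ _).
  rewrite /inrange => rb; have -> : `|c.2|%N%:Z = c.2 by lia.
  by rewrite -surjective_pairing; exact: reach_refl.
have bR k : R k -> (k <= m)%N.
  by move=> /asboolP [q /inr]; rewrite /inrange /=; lia.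
have [b /asboolP [q cd] bmax] := ex_maxnP exR bR.
have le : (b <= m)%N by apply: bR; apply/asboolP; exists q.
have low e : reach F (q, b%:Z) e -> e.2 < b.+1%:Z.
  move=> de; have ce := reach_trans cd de; have := inr _ ce; rewrite /inrange => rb.
  have /bmax : R `|e.2|%N.
    apply/asboolP; exists e.1; have -> : `|e.2|%N%:Z = e.2 by lia.
    by rewrite -surjective_pairing.
  by lia.
have lowp n d e : reach F (q, b%:Z) d -> piter F n d = Some e -> piter (left_of b.+1) n d = Some e.
  elim: n d => //= n IH d dr; case fd: (F d) => [d'|//] /= h.
  have -> : left_of b.+1 d = Some d' by rewrite /left_of low.
  by apply: IH h; exact: reach_trans dr (reach_step fd).
have [n dn] := recurrent_reach rc cd.
have [[|j] [hj j0]] := stay_complete le (lowp _ _ _ (reach_refl _ _) dn).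
  by have := j0 isT.
pose stay := stay_step (y b%:Z) (profile b%:Z).
have rq : recurrent stay q by exists j.
pose O r := `[< reach stay q r >].
have Oq : O q by apply/asboolP; exact: reach_refl.
case: (arg_minnP (fun r : St => nat_of_ord (enum_rank r)) Oq) => s /asboolP qs smin.
exists (s, b%:Z).
  by apply: reach_trans cd (left_of_reach _); case: qs => k; exact: stay_reach.
rewrite /is_cut /= /inrange; apply/andP; split; first by lia.
apply/asboolP; split; first exact: recurrent_reach rq qs.
by move=> i r ir; apply: smin; apply/asboolP; apply: reach_trans qs _; exists i.
Qed.

End CutRun.
End Cuts.

(** * Hopping over the cycles of the nonzero graph *)

Section Hop.
Context {A : Type} (M : machine A) (lft rgt : A -> bool).
Local Notation St := (mst M).
Local Notation B := (A * {ffun St -> option St})%type.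

(** Undefined at counter zero too, so that the ancestors explored belong to a single excursion from
    zero. *)
Definition uncut_delta (ap : B) (s : bool) (q : St) : option St :=
  if s && ~~ cut ap.1 ap.2 q then mdelta ap.1 true q else None.

Fact uncut_halt ap s q : macc q || mrej q -> uncut_delta ap s q = None.
Proof. by move=> h; rewrite /uncut_delta mhalt // if_same. Qed.

Definition uncut : machine B :=
  @Machine _ (mst M) uncut_delta (@mctr _ M) (@mmov _ M) (mini M) (@macc _ M) (@mrej _ M)
    (mini_live M) (@macc_rej _ M) uncut_halt.

Local Notation blft := (fun ap : B => lft ap.1).
Local Notation brgt := (fun ap : B => rgt ap.1).

(* By [cut_return] the second cut configuration of an excursion from zero has the same
   vertex as the first.  Its uncut ancestors are toured until one is found that has just
   left zero.  Run from there, M enters the second configuration along a path without cut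
   vertices, so that the excursion may be regarded as starting one round later. *)
Local Notation one q := (inl (inl q)).
Local Notation two q := (inl (inr q)).

Definition hop_delta (ap : B) (s : bool) (st : (St + St) + (St + St)) :
    option ((St + St) + (St + St)) :=
  match st with
  | one q => if s && cut ap.1 ap.2 q then omap (fun r => two r) (mdelta ap.1 true q)
             else omap (fun r => one r) (mdelta ap.1 s q)
  | two q => if ~~ s then omap (fun r => one r) (mdelta ap.1 false q)
             else if cut ap.1 ap.2 q then Some (inr (inr q))
             else omap (fun r => two r) (mdelta ap.1 true q)
  | inr d => if s then omap inr (@tour_delta _ uncut blft brgt ap true d)
             else if d is inr r then Some (one r) else None
  end.

Definition hop_ctr (st : (St + St) + (St + St)) : tri :=
  match st with one q | two q => mctr q | inr d => @tour_ctr _ uncut d end.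
Definition hop_mov (st : (St + St) + (St + St)) : tri :=
  match st with one q | two q => mmov q | inr d => @tour_mov _ uncut d end.
Definition hop_acc (st : (St + St) + (St + St)) : bool :=
  match st with one q | two q => macc q | inr _ => false end.
Definition hop_rej (st : (St + St) + (St + St)) : bool :=
  match st with one q | two q => mrej q | inr _ => false end.

Fact hop_live : ~~ (hop_acc (one (mini M)) || hop_rej (one (mini M))).
Proof. exact: mini_live. Qed.

Fact hop_acc_rej st : ~~ (hop_acc st && hop_rej st).
Proof. by case: st => [[q|q]|d] //=; exact: macc_rej. Qed.

Fact hop_halt ap s st : hop_acc st || hop_rej st -> hop_delta ap s st = None.
Proof.
case: st => [[q|q]|d] //= h; rewrite !mhalt //= ?if_same //.
by case: s => //=; case: ifP => // k; case: (cut_live k); rewrite mhalt.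
Qed.

Definition hop : machine B := Machine hop_ctr hop_mov hop_live hop_acc_rej hop_halt.

Section HopRun.
Variables (y : int -> A) (m : nat).
Hypothesis lftE : forall b, inrange m b -> lft (y b) = (b == 0).
Hypothesis rgtE : forall b, inrange m b -> rgt (y b) = (b == m%:Z).
Hypothesis gM : guarded M lft rgt.

Let y1 (b : int) : B := (y b, profile M y b).
Local Notation cutb := (is_cut (M := M) y m).

Lemma uncut_guarded : guarded uncut blft brgt.
Proof. by move=> ap s q q' /=; rewrite /uncut_delta; case: ifP => // _; exact: gM. Qed.

Lemma nzstep_uncut : nzstep uncut y1 m =1 uncut_step y m.
Proof.
move=> [q b]; rewrite /uncut_step /nzstep /is_cut /= /uncut_delta /=.
by case: (inrange m b) => //=; case: (cut _ _ _).
Qed.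

Lemma uncut_step_acyclic c : ~ recurrent (uncut_step (M := M) y m) c.
Proof.
move=> rc; have live d : reach (uncut_step y m) c d -> ~~ cutb d.
  move=> /(recurrent_reach rc)/recurrentP [e]; rewrite /uncut_step.
  by case: ifP.
have [|e [n ce] ke] := @cycle_has_cut _ M y m c.
  by have [n /uncut_sub] := rc; exists n.
suff /live : reach (uncut_step y m) c e by rewrite ke.
exists n; move: ce; elim: n {rc} c live => //= n IH c live.
case F: nzstep => [d|//] /= de; have u : uncut_step y m c = Some d.
  by rewrite /uncut_step (negbTE (live c (reach_refl _ _))).
by rewrite u /=; apply: IH de => e' /(reach_next u); exact: live.
Qed.

Lemma uncut_acyclic c : ~ recurrent (nzstep uncut y1 m) c.
Proof. by rewrite (funext nzstep_uncut); exact: uncut_step_acyclic. Qed.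

(** While the counter is nonzero the phases only advance, so a cycle of the nonzero graph stays
    within one phase. *)
Definition hop_rank (st : mst hop) : nat :=
  match st with one _ => 0 | two _ => 1 | inr _ => 2 end.

Lemma nz_hop_rank n c d : piter (nzstep hop y1 m) n c = Some d ->
  (hop_rank c.1 <= hop_rank d.1)%N.
Proof.
elim: n c => [|n IH] c /=; first by case=> ->.
case e: nzstep => [c'|//] /= /IH; apply: leq_trans.
move: e; rewrite /nzstep; case: c => [st b]; case: ifP => //= _.
case e: hop_delta => [st'|//]; case: ifP => // _ [<-] /=.
case: st e => [[q|q]|d'] //=.
  by case: (cut _ _ q) => [[<-]|] //; case: (mdelta _ _ q) => // r [<-].
by case: tour_delta => // d'' [<-].
Qed.

Lemma nz_one n q b q' b' :
  piter (nzstep hop y1 m) n (one q, b) = Some (one q', b') ->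
  piter (uncut_step y m) n (q, b) = Some (q', b').
Proof.
elim: n q b => [|n IH] q b; first by case=> -> ->.
rewrite [in X in X -> _]/=; case e: nzstep => [[st c]|//] h; have := nz_hop_rank h; move: e.
rewrite [nzstep _ _ _ _]/nzstep; case: ifP => // rb; rewrite /=.
case k: (cut _ _ q); case d: (mdelta _ _ q) => [r|] //=;
  case: ifP => // rr [se ce] //; subst st c => // _.
have -> : uncut_step y m (q, b) = Some (r, b + mu (mmov r)).
  by rewrite /uncut_step /is_cut /nzstep /= rb k d rr.
exact: IH h.
Qed.

Lemma nz_two n q b q' b' :
  piter (nzstep hop y1 m) n (two q, b) = Some (two q', b') ->
  piter (uncut_step y m) n (q, b) = Some (q', b').
Proof.
elim: n q b => [|n IH] q b; first by case=> -> ->.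
rewrite [in X in X -> _]/=; case e: nzstep => [[st c]|//] h; have := nz_hop_rank h; move: e.
rewrite [nzstep _ _ _ _]/nzstep; case: ifP => // rb; rewrite /=.
case k: (cut _ _ q); first by case: ifP => // _ [<-].
case d: (mdelta _ _ q) => [r|] //=; case: ifP => // rr [se ce]; subst st c => _.
have -> : uncut_step y m (q, b) = Some (r, b + mu (mmov r)).
  by rewrite /uncut_step /is_cut /nzstep /= rb k d rr.
exact: IH h.
Qed.

Lemma nz_dart n d b st b' :
  piter (nzstep hop y1 m) n (inr d, b) = Some (st, b') ->
  exists2 d', st = inr d' &
    piter (nzstep (tour uncut blft brgt) y1 m) n (d, b) = Some (d', b').
Proof.
elim: n d b => [|n IH] d b /=; first by case=> <- ->; exists d.
case e: nzstep => [[st' c]|//] /= h; move: e; rewrite /nzstep /=; case: ifP => // _ /=.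
case: tour_delta => // d' /=; case: ifP => // _ [se ce]; subst st' c.
exact: IH h.
Qed.

Lemma hop_acyclic c : ~ recurrent (nzstep hop y1 m) c.
Proof.
case: c => [[[q|q]|d] b] [n h].
- by apply: (@uncut_step_acyclic (q, b)); exists n; exact: nz_one h.
- by apply: (@uncut_step_acyclic (q, b)); exists n; exact: nz_two h.
have [d' [<-] h'] := nz_dart h.
apply: (@tour_acyclic _ uncut blft brgt y1 m) uncut_acyclic (d, b) _ => //.
by exists n.
Qed.

(** * Paths with nonzero counter and their shifts *)

Definition fstep (P : pred (St * int)) (c : St * place) : option (St * place) :=
  if (c.2.1 != 0) && P (c.1, c.2.2) then step M y m c else None.

Definition raise (w : int) (c : St * place) : St * place := (c.1, (c.2.1 + w, c.2.2)).

Definition same_sign (a b : int) : Prop := 0 < a /\ 0 < b \/ a < 0 /\ b < 0.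

Local Notation unc := (fun v => ~~ cutb v).

Lemma stepP c d : step M y m c = Some d ->
  [/\ mdelta (y c.2.2) (sigd c.2) c.1 = Some d.1, d.2 = shift d.1 c.2 & inrange m d.2.2].
Proof. by rewrite /step; case: (mdelta _ _ _) => // q; case: ifP => // r [<-]. Qed.

Lemma fstepP P c d : fstep P c = Some d ->
  [/\ c.2.1 <> 0, P (c.1, c.2.2) & step M y m c = Some d].
Proof. by rewrite /fstep; case: ifP => // /andP[/eqP]. Qed.

Lemma fstep_sub P n c d : piter (fstep P) n c = Some d -> piter (step M y m) n c = Some d.
Proof.
elim: n c => //= n IH c; case e: (fstep P c) => [c'|//] /= /IH.
by have [_ _ ->] := fstepP e.
Qed.

Lemma fstep_weak P n c d : piter (fstep P) n c = Some d -> piter (fstep predT) n c = Some d.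
Proof.
elim: n c => //= n IH c; case e: (fstep P c) => [c'|//] /= /IH.
have [/eqP h _ h'] := fstepP e.
by have -> : fstep predT c = Some c' by rewrite /fstep h.
Qed.

Lemma fstep_sign P n c d : piter (fstep P) n c = Some d -> d.2.1 <> 0 -> same_sign c.2.1 d.2.1.
Proof.
move=> + d0; elim: n c => [|n IH] c /=; first by case=> ->; rewrite /same_sign; lia.
case e: (fstep P c) => [c'|//] /= /IH; have [c0 _ /step_ctr] := fstepP e.
by rewrite /same_sign; lia.
Qed.

Lemma fstep_raise1 P w c d : fstep P c = Some d -> c.2.1 + w <> 0 ->
  fstep P (raise w c) = Some (raise w d).
Proof.
move=> e w0; have [/eqP c0 Pc st] := fstepP e; have [dl dE rd] := stepP st.
rewrite /fstep /= Pc andbT; case: eqP => // _; rewrite /step /sigd /=.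
have -> : c.2.1 + w != 0 by apply/eqP.
move: dl; rewrite /sigd c0 => ->; rewrite /= -[_ + mu (mmov _)]/(shift d.1 c.2).2 -dE rd.
by congr (Some (_, (_, _))); [rewrite dE /=; lia|rewrite dE].
Qed.

(** The machine sees only the sign of the counter, so a path may be shifted away from zero. *)
Lemma fstep_raise P w n c d : piter (fstep P) n c = Some d -> d.2.1 <> 0 ->
  (0 < c.2.1 -> 0 <= w) -> (c.2.1 < 0 -> w <= 0) ->
  piter (fstep P) n (raise w c) = Some (raise w d).
Proof.
move=> + d0; elim: n c => [|n IH] c /=; first by case=> ->.
case e: (fstep P c) => [c'|//] /= h wp wn; have [c0 _ /step_ctr b] := fstepP e.
rewrite (fstep_raise1 (w := w) e) /=; last by lia.
by have := fstep_sign h d0; rewrite /same_sign => ss; apply: IH h _ _; lia.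
Qed.

Lemma fstep_uncut c d : inrange m c.2.2 -> fstep unc c = Some d ->
  uncut_step y m (c.1, c.2.2) = Some (d.1, d.2.2).
Proof.
move=> r /fstepP[/eqP c0 /negbTE k /stepP[e dE rd]].
rewrite /uncut_step k /nzstep /= r; move: e; rewrite /sigd c0 => ->.
by move: rd; rewrite dE /= => ->.
Qed.

Lemma fstep_uncutn n c d : inrange m c.2.2 -> piter (fstep unc) n c = Some d ->
  piter (uncut_step y m) n (c.1, c.2.2) = Some (d.1, d.2.2).
Proof.
elim: n c => [|n IH] c r /=; first by case=> ->.
case e: (fstep unc c) => [c'|//] /=; rewrite (fstep_uncut r e) /=; apply: IH.
by have [_ _ /step_inrange] := fstepP e.
Qed.

(** Either the shifted path keeps one sign throughout, or the configuration after its last zero has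
    just left zero and leads to the shifted end. *)
Lemma raise_touch P n t c0 c : piter (fstep P) n c0 = Some c -> c.2.1 + t <> 0 ->
  (exists2 x, reach (fstep P) x (raise t c) & inrange m x.2.2 /\ x.2.1 - mu (mctr x.1) = 0) \/
  same_sign (c0.2.1 + t) (c.2.1 + t) /\ reach (fstep P) (raise t c0) (raise t c).
Proof.
move=> + ct; elim: n c0 => [|n IH] c0 /=.
  by case=> ->; right; split; [rewrite /same_sign; lia|exact: reach_refl].
case e: (fstep P c0) => [c1|//] /= /IH [?|[ss r]]; first by left.
have [_ _ st] := fstepP e; have b := step_ctr st.
have [z|nz] := eqVneq (c0.2.1 + t) 0.
  left; exists (raise t c1) => //=; split; first exact: step_inrange st.
  by have [_ -> _] := stepP st; rewrite /=; lia.
right; split; first by move: ss b nz; rewrite /same_sign; lia.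
by apply: reach_next r; apply: fstep_raise1 e _; apply/eqP.
Qed.

(* A cycle of vertices along which the counter does not approach zero is run forever. *)
Lemma drift_runs n c t : piter (fstep predT) n.+1 c = Some (raise t c) -> c.2.1 + t <> 0 ->
  (0 < c.2.1 -> 0 <= t) -> (c.2.1 < 0 -> t <= 0) ->
  forall K h, piter (step M y m) K c = Some h -> step M y m h <> None.
Proof.
move=> h ct tp tn K x Kx xN.
have runs k : piter (step M y m) (k * n.+1) c = Some (raise (t *+ k) c).
  elim: k => [|k IH]; first by rewrite mul0n mulr0n /raise addr0 /=; case: (c) => q [].
  rewrite mulSn addnC piterD IH /= -/(piter _ n.+1 _).
  have /fstep_sub -> : piter (fstep predT) n.+1 (raise (t *+ k) c) =
      Some (raise (t *+ k) (raise t c)).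
    apply: fstep_raise h _ _ _ => /= [|c0|c0]; first by lia.
      by apply: mulrn_wge0; exact: tp.
    by apply: mulrn_wle0; exact: tn.
  by congr (Some (_, (_, _))) => /=; rewrite mulrS; lia.
have lt : (K < K.+1 * n.+1)%N by lia.
have [z + _] := piter_prefix lt (runs K.+1).
by rewrite piterSr Kx /= xN.
Qed.

(** * Correctness of the hopping machine *)

Local Notation hstep := (step hop y1 m).
Local Notation hone c := ((one c.1 : mst hop), c.2).
Local Notation htwo c := ((two c.1 : mst hop), c.2).
Local Notation tstep := (step (tour uncut blft brgt) y1 m).
Local Notation uphi := (@tphi _ uncut blft brgt y1 m).

Lemma hop_move st st' p : hop_delta (y1 p.2) (sigd p) st = Some st' ->
  inrange m (p.2 + mu (hop_mov st')) ->
  hstep (st, p) = Some (st', (p.1 + mu (hop_ctr st'), p.2 + mu (hop_mov st'))).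
Proof. by move=> e r; rewrite /step /= e /= r. Qed.

Lemma hop_zero c d : c.2.1 = 0 -> step M y m c = Some d ->
  hstep (hone c) = Some (hone d) /\ hstep (htwo c) = Some (hone d).
Proof.
move=> c0 /stepP[]; rewrite /sigd c0 eqxx => e -> r.
by rewrite !(@hop_move _ (one d.1)) //= /sigd c0 eqxx /= e.
Qed.

Lemma hop_uncut c d : inrange m c.2.2 -> fstep unc c = Some d ->
  hstep (hone c) = Some (hone d) /\ hstep (htwo c) = Some (htwo d).
Proof.
move=> rc /fstepP[/eqP c0]; rewrite /is_cut /= rc /= => /negbTE k /stepP[].
rewrite /sigd c0 => e -> r.
by rewrite (@hop_move _ (one d.1)) ?(@hop_move _ (two d.1)) //= /sigd c0 /= k e.
Qed.

Lemma hop_cut c d : c.2.1 <> 0 -> cutb (c.1, c.2.2) -> step M y m c = Some d ->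
  hstep (hone c) = Some (htwo d).
Proof.
move=> /eqP c0; rewrite /is_cut /= => /andP[_ k] /stepP[]; rewrite /sigd c0 => e -> r.
by rewrite (@hop_move _ (two d.1)) //= /sigd c0 /= k e.
Qed.

(** A cut state has a transition, so [gM] guarantees that the cell it would be entered from is on
    the tape. *)
Lemma hop_turn c : c.2.1 <> 0 -> cutb (c.1, c.2.2) ->
  hstep (htwo c) = Some ((inr (inr c.1) : mst hop), unshift c.1 c.2) /\
  inrange m (unshift c.1 c.2).2.
Proof.
move=> /eqP c0; rewrite /is_cut /= => /andP[rc k].
case e: (mdelta (y c.2.2) true c.1) => [q|]; last by have := cut_live k.
have /andP[+ _] := gM e; rewrite (okin_inrange lftE rgtE) // => r; split=> //.
rewrite (@hop_move _ (inr (inr c.1))) /= /sigd ?c0 /= ?k ?mu_tneg //.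
Qed.

Lemma hop_tour d p c : p.1 <> 0 -> tstep (d, p) = Some c ->
  hstep (inr d, p) = Some ((inr c.1 : mst hop), c.2).
Proof.
move=> /eqP p0; rewrite /step /= /sigd p0 /=; case: tour_delta => //= d' .
by case: ifP => // _ [<-].
Qed.

Lemma hop_found r p : p.1 = 0 -> inrange m (shift r p).2 ->
  hstep (inr (inr r), p) = Some ((one r : mst hop), shift r p).
Proof. by move=> p0 rp; rewrite (@hop_move _ (one r)) //= /sigd p0. Qed.

Let stop (p : place) := p.1 == 0.
Local Notation ustep := (sstep uphi (@shift _ M) (@unshift _ M) stop).

Lemma hop_sstep c d : good (lft := blft) (rgt := brgt) m c ->
  reach ustep c d ->
  reach hstep ((inr c.1 : mst hop), c.2) ((inr d.1 : mst hop), d.2) /\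
  good (lft := blft) (rgt := brgt) m d.
Proof.
move=> + [n]; elim: n c => [|n IH] c gc /=; first by case=> <-; split=> //; exact: reach_refl.
case e: (ustep c) => [c'|//] /= /IH h.
have es : estep uphi (@shift _ M) (@unshift _ M) c = Some c'.
  by move: e; rewrite /sstep; case: (c.1) => // r; case: ifP.
have [ts gc'] := @est_step _ uncut blft brgt y1 m lftE rgtE _ _ gc es.
have [hr gd] := h gc'; split=> //; apply: reach_next hr.
(* At counter zero nothing moves: [inr] is stopped, and [inl] has no transition in [uncut]. *)
case: c gc e es ts => [d' p] gc e es ts; apply: hop_tour ts => p0.
move: e es; rewrite /sstep /stop p0 /=; case: d' {gc} => [q|r //] _.
rewrite /estep /= /tphi /gdelta /= /sigd p0 /=.
by case: ifP.
Qed.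

Lemma astep_fstep c d : astep uphi (@shift _ M) c = Some d <->
  inrange m c.2.2 /\ fstep unc c = Some d.
Proof.
case: c => q p; rewrite /astep /tphi /= /fstep /step /is_cut /=.
case: ifP => r /=; last by split=> [|[]].
rewrite (gdelta_guarded _ _ _ uncut_guarded) /= /uncut_delta /= /sigd.
case: (p.1 != 0) => /=; last by split=> [|[]].
case: (cut (y p.2) (profile M y p.2) q) => /=; first by split=> [|[]].
case e: (mdelta (y p.2) true q) => [q'|] /=; last by split=> [|[]].
have /andP[_] := gM e; rewrite (okout_inrange lftE rgtE) // => ->.
by split=> [|[]].
Qed.

(** Invariant of the first phase: an uncut path leads to [c] from a configuration that has just left
    zero. *)
Definition started (c : St * place) : Prop := c.2.1 <> 0 ->
  exists2 x, reach (fstep unc) x c & inrange m x.2.2 /\ x.2.1 - mu (mctr x.1) = 0.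

Definition finishes (h : St * place) (c : mst hop * place) : Prop :=
  reach hstep c (hone h) \/ reach hstep c (htwo h).

Lemma finishes_reach h c d : reach hstep c d -> finishes h d -> finishes h c.
Proof. by move=> cd [dh|dh]; [left|right]; exact: reach_trans cd dh. Qed.

Lemma astep_reach n c d : piter (astep uphi (@shift _ M)) n c = Some d ->
  piter (fstep unc) n c = Some d.
Proof.
elim: n c => //= n IH c; case e: (astep _ _ c) => [c'|//] /= /IH.
by have [_ ->] := (astep_fstep _ _).1 e.
Qed.

Lemma fstep_ancestor c d : inrange m c.2.2 -> reach (fstep unc) c d ->
  reach (astep uphi (@shift _ M)) c d.
Proof.
move=> + [n]; elim: n c => [|n IH] c rc /=; first by case=> ->; exact: reach_refl.
case e: (fstep unc c) => [c'|//] /= h; apply: reach_next (IH _ _ h).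
  exact/astep_fstep.
by have [_ _ /step_inrange] := fstepP e.
Qed.

Lemma hop_uncutn n c d : inrange m c.2.2 -> piter (fstep unc) n c = Some d ->
  reach hstep (hone c) (hone d).
Proof.
elim: n c => [|n IH] c rc /=; first by case=> ->; exact: reach_refl.
case e: (fstep unc c) => [c'|//] /= h.
apply: (reach_next (hop_uncut rc e).1 (IH _ _ h)).
by have [_ _ /step_inrange] := fstepP e.
Qed.

(** Here [a] is the counter just after leaving zero, so it is 1 or -1; if [a + t] keeps its sign,
    then [t] points away from zero. *)
Lemma drift_sign (a b c t : int) : a - b = 0 -> -1 <= b <= 1 ->
  same_sign (a + t) (c + t) -> same_sign a c -> same_sign c (c + t) ->
  (0 < c -> 0 <= t) /\ (c < 0 -> t <= 0).
Proof. by rewrite /same_sign; lia. Qed.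

(** The tour started at the second cut configuration [e] must find an ancestor that has just left
    zero. From there the first phase leads back to [e], where [started] holds again and the
    induction hypothesis applies. *)
Lemma hop_around K c d e n h :
  (forall K' c', (K' < K)%N -> piter (step M y m) K' c' = Some h -> inrange m c'.2.2 ->
     started c' -> finishes h (hone c')) ->
  macc h.1 || mrej h.1 -> inrange m c.2.2 -> started c ->
  c.2.1 <> 0 -> cutb (c.1, c.2.2) -> step M y m c = Some d ->
  piter (fstep unc) n d = Some e -> e.2.1 <> 0 -> cutb (e.1, e.2.2) ->
  forall Ke, (Ke < K)%N -> piter (step M y m) Ke e = Some h -> finishes h (htwo e).
Proof.
move=> IH hh rc sc c0 cc cd de e0 ce Ke ltK eh.
have rd := step_inrange cd.
have re : inrange m e.2.2 := piter_inrange (fstep_sub de) rd.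
have fc : fstep predT c = Some d by rewrite /fstep; case: eqP.
have ef : piter (fstep predT) n.+1 c = Some e by rewrite /= fc /=; exact: fstep_weak de.
have ve : (e.1, e.2.2) = (c.1, c.2.2).
  apply: (cut_return cc _ (fstep_uncutn rd de) ce).
  have [+ dE rd'] := stepP cd; rewrite /nzstep /= rc /sigd; have /eqP -> := c0.
  by move=> ->; move: rd'; rewrite dE /= => ->.
have eE : e = raise (e.2.1 - c.2.1) c.
  case: (e) ve => q [a b] /= [-> ->].
  by rewrite /raise /=; have -> : c.2.1 + (a - c.2.1) = a by lia.
pose t : int := e.2.1 - c.2.1; rewrite -/t in eE.
have ct : c.2.1 + t <> 0 by rewrite /t; lia.
have ss := fstep_sign ef e0.
have hN := step_halt y m hh.
(* A drift away from zero would repeat the round forever, although [h] is reached. *)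
have drift : ~ ((0 < c.2.1 -> 0 <= t) /\ (c.2.1 < 0 -> t <= 0)).
  move=> [tp tn]; rewrite eE in ef.
  have ch : piter (step M y m) (n.+1 + Ke) c = Some h.
    by rewrite piterD (fstep_sub ef) /= -eE.
  by have := drift_runs ef ct tp tn ch.
(* The path that led from zero to [c], shifted by [t], ends in [e] and must touch zero. *)
have [x xe [rx x0]] : exists2 x, reach (fstep unc) x e &
    inrange m x.2.2 /\ x.2.1 - mu (mctr x.1) = 0.
  have [[q0 [a0 b0]] [k xc] [/= _ x00]] := sc c0; rewrite eE.
  have [//|[/= s1 _]] := raise_touch xc ct.
  have /= s2 := fstep_sign xc c0; have tE : e.2.1 = c.2.1 + t by rewrite /t; lia.
  case: drift; rewrite tE in ss; apply: drift_sign x00 (mu_bound _) s1 s2 ss.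
have [turn rt] := hop_turn e0 ce.
have [|[r [p [p1 /eqP p2 /= p3]]]|[_ tor]] := @tour_subtree _ _ uphi (@shift _ M) (@unshift _ M)
    (@shiftK _ M) (@unshiftK _ M) stop (#|mst M| * m.+1)%N e.1 e.2.
- case=> [//|k] [q' p'] xe'.
  apply: (nz_bounded (M := uncut) uncut_acyclic); rewrite (funext nzstep_uncut).
  apply: fstep_uncutn (astep_reach xe').
  by move: xe' => /=; case a: (astep _ _ _) => [z|//] _; have [] := (astep_fstep _ _).1 a.
- have gd : good (lft := blft) (rgt := brgt) m
      ((inr e.1 : mst (tour uncut blft brgt)), unshift e.1 e.2).
    by rewrite /good /= subrK re andbT.
  have [hr /andP[_ gr]] := hop_sstep gd p1.
  have fr : inrange m (shift r p).2 by rewrite /= in gr.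
  have [k /astep_reach pe] := p3; rewrite -surjective_pairing in pe.
  apply: (finishes_reach (reach_next turn (reach_trans hr (reach_next (hop_found p2 fr) _)))).
    by apply: hop_uncutn pe.
  apply: (IH _ _ ltK eh re) => _; exists (r, shift r p); first by exists k.
  by split=> //=; rewrite addrK.
(* A completed tour would have met no such ancestor, contradicting the existence of [x]. *)
have /tor : reach (astep uphi (@shift _ M)) x (e.1, e.2).
  by rewrite -surjective_pairing; exact: fstep_ancestor.
by rewrite /stop /= x0.
Qed.

(** Strong induction on the number of steps that [M] still has to make. A detour returns to the same
    configuration [e], but [e] lies at least one step after the first cut configuration [c], so the
    number has dropped. *)
Lemma hop_finishes K c h : piter (step M y m) K c = Some h -> macc h.1 || mrej h.1 ->
  inrange m c.2.2 -> started c -> finishes h (hone c).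
Proof.
move=> + hh; elim/ltn_ind: K c => K IHK c ch rc sc.
have IH K' c' : (K' < K)%N -> piter (step M y m) K' c' = Some h -> inrange m c'.2.2 ->
  started c' -> finishes h (hone c') by move=> lt; exact: IHK.
case: K ch {IHK} IH => [|K] /= ch IH; first by case: ch => ->; left; exact: reach_refl.
case cd: (step M y m c) ch => [d|//] /= dh; have rd := step_inrange cd.
have fresh c1 c2 : c1.2.1 = 0 -> step M y m c1 = Some c2 -> started c2.
  move=> z st _; exists c2; first exact: reach_refl.
  by have [_ -> r] := stepP st; split; [move: r|rewrite /= z]; lia.
have [c0|/eqP c0] := eqVneq c.2.1 0.
  apply: (finishes_reach (reach_step (hop_zero c0 cd).1)).
  by apply: (IH K) => //; exact: fresh cd.
have [cc|nc] := boolP (cutb (c.1, c.2.2)); last first.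
  have f : fstep unc c = Some d by rewrite /fstep nc andbT; case: eqP.
  apply: (finishes_reach (reach_step (hop_uncut rc f).1)).
  apply: (IH K) => // _; have [x xc hx] := sc c0; exists x => //.
  exact: reach_trans xc (reach_step f).
apply: (finishes_reach (reach_step (hop_cut c0 cc cd))).
(* The second phase keeps the uncut path from [d] as its invariant; the outer induction takes over
   at counter zero or at the second cut. *)
suff two_phase Ke n e : (Ke <= K)%N -> piter (fstep unc) n d = Some e ->
    piter (step M y m) Ke e = Some h -> finishes h (htwo e).
  exact: (@two_phase K 0%N).
elim: Ke n e => [|Ke IHe] n e lt de /= eh.
  by case: eh => ->; right; exact: reach_refl.
have re := piter_inrange (fstep_sub de) rd.
case ee: (step M y m e) eh => [e'|//] /= eh.
have [e0|/eqP e0] := eqVneq e.2.1 0.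
  apply: (finishes_reach (reach_step (hop_zero e0 ee).2)).
  by apply: (IH Ke); [lia|exact: eh|exact: step_inrange ee|exact: fresh ee].
have [ce|ne] := boolP (cutb (e.1, e.2.2)).
  by apply: (hop_around IH hh rc sc c0 cc cd de e0 ce (Ke := Ke.+1)); rewrite /= ?ee.
have f : fstep unc e = Some e' by rewrite /fstep ne andbT; case: eqP.
apply: (finishes_reach (reach_step (hop_uncut re f).2)).
by apply: (IHe n.+1) eh; [lia|rewrite piterSr de].
Qed.

End HopRun.
End Hop.

Section HopSolves.
Context {X : Type} (m : X -> nat) {A : Type} (M : machine A) (T : X -> int -> A).
Variables (lft rgt : A -> bool).
Hypothesis lftE : forall x b, inrange (m x) b -> lft (T x b) = (b == 0).
Hypothesis rgtE : forall x b, inrange (m x) b -> rgt (T x b) = (b == (m x)%:Z).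
Hypothesis gM : guarded M lft rgt.

Lemma hop_solves L : solves m M T L ->
  solves m (hop M lft rgt) (annotate T (fun x => profile M (T x))) L.
Proof.
move=> sM x; have fin h : reach (step M (T x) (m x)) (minit M) h -> macc h.1 || mrej h.1 ->
    @finishes _ M lft rgt (T x) (m x) h (minit (hop M lft rgt)).
  move=> [n nh] hh.
  have st : started (T x) (m x) (minit M) by [].
  exact: (hop_finishes (@lftE x) (@rgtE x) gM nh hh (init_inrange _ _) st).
by split=> [/(sM x).1|/(sM x).2] [h rh hh];
  (have [|r|r] := fin h rh; first by rewrite hh ?orbT);
  [exists (inl (inl h.1), h.2)|exists (inl (inr h.1), h.2)|
   exists (inl (inl h.1), h.2)|exists (inl (inr h.1), h.2)].
Qed.

Lemma guarded_solvable L : mmov (mini M) = tri0 -> solves m M T L -> solvable m T L.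
Proof.
move=> mv0 sM; have lm : left_marked m T by exists lft.
have prof : computable m T (fun x => profile M (T x)).
  by move=> L'; exact: dfa_label_computable.
apply: prof; apply: (@solvable_acyclic _ _ _ (hop M lft rgt)) (hop_solves sM) => //.
- exact: left_marked_annotate lm.
- by exists (fun ap => rgt ap.1) => x; exact: rgtE.
by move=> x c; exact: (hop_acyclic (@lftE x) (@rgtE x)).
Qed.

End HopSolves.

Theorem theorem12 (Sigma : finType) (L : seq Sigma -> Prop) :
  (exists (Q : finType) (M : D1CA Sigma Q), d_recognizes M L) ->
  exists (Q' : finType) (M' : Q1CA Sigma Q'),
    is_R1CA M' /\ is_simple M' /\
    forall x : seq Sigma,
      (L x -> acc_prob_is M' x 1) /\ (~ L x -> rej_prob_is M' x 1).
Proof.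
move=> [Q [M /linear_solves sM]]; apply: solvable_R1CA.
have [lft lftE] := tape_left_marked Sigma; have [rgt rgtE] := tape_right_marked Sigma.
have gM := @guard_guarded _ (linear M) lft rgt.
have mv0 : mmov (mini (linear M)) = tri0 by [].
exact: (guarded_solvable lftE rgtE gM mv0 (guard_solves lftE rgtE mv0 sM)).
Qed.
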